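(* Consider the nested tessellation $S_{\rm N}=S_o\cup\bigcup_{i\in J}(S_i\cap C_i)$ with first-layer tessellation $S_o$, whose cells are $(C_i)_{i\in J}$, and second-layer tessellations $S_i$, $i\in J$, which are all distributed as one tessellation $S'$. Let $V=\#\{i\in J: C_i\cap B_1\ne\emptyset\}$ be the number of cells of $S_o$ intersecting $B_1$. (i) If $\mathbb{E}[\exp(\alpha V)]<\infty$ for all $\alpha\in\mathbb{R}$ and $\mathbb{E}[\exp(\alpha|S'\cap B_1|)]<\infty$ for all $\alpha\in\mathbb{R}$, then $\mathbb{E}[\exp(\alpha|S_{\rm N}\cap B_1|)]<\infty$ for all $\alpha\in\mathbb{R}$. (ii) If $\mathbb{E}[\exp(\alpha V)]<\infty$ for some $\alpha>0$ and $\mathbb{E}[\exp(\alpha|S'\cap B_1|)]<\infty$ for some $\alpha>0$, then $\mathbb{E}[\exp(\alpha|S_{\rm N}\cap B_1|)]<\infty$ for some $\alpha>0$.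
   Context: Notation. $B_1\subset\mathbb{R}^2$ is the closed unit disk centered at the origin. For a tessellation $S$ and measurable $A\subset\mathbb{R}^2$, $|S\cap A|=\nu_1(S\cap A)$ is the total edge length in $A$, $\nu_1$ being one-dimensional Hausdorff measure. For points, $|\cdot|$ is the Euclidean norm. $\partial A$ is the boundary of $A$; $\#$ denotes cardinality. Basic tessellation processes. Let $X=\{X_i\}_{i\in I}$ be a stationary point process on $\mathbb{R}^2$ with intensity $0<\lambda<\infty$; write $X_i=(X_{i,1},X_{i,2})$. - Voronoi: $S_{\rm V}(X)=\bigcup_{i\in I}\partial\{x\in\mathbb{R}^2: |x-X_i|=\inf_{j\in I}|x-X_j|\}$. - Delaunay: $S_{\rm D}(X)=\bigcup_{i,j\in I,\,s\in[0,1]}\{sX_i+(1-s)X_j:\ \exists x\in S_{\rm V}(X)\text{ with }|x-X_i|=|x-X_j|=\inf_{k\in I}|x-X_k|\}$. - Line tessellation: $S_{\rm L}(X)=\bigcup_{i\in I:\,X_i\in\mathbb{R}\times[0,\pi)}\{x\in\mathbb{R}^2: x_1\cos X_{i,2}+x_2\sin X_{i,2}=X_{i,1}\}$. - Johnson--Mehl: for an i.i.d. marked stationary point process $\widetilde X=\{(X_i,T_i)\}_{i\in I}$ on $\mathbb{R}^2\times[0,\infty)$ with mark measure $\mu$ (absolutely continuous with respect to Lebesgue measure) and $d_{\rm J}((x,s),(y,t))=|x-y|+|t-s|$, $S_{\rm J}(\widetilde X)=\bigcup_{i\in I}\partial\{x\in\mathbb{R}^2: d_{\rm J}((x,0),(X_i,T_i))=\inf_{j\in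 I}d_{\rm J}((x,0),(X_j,T_j))\}$. - Manhattan grid: for independent simple stationary point processes $Y_{\rm v}=\{Y_{i,\rm v}\}_{i\in I_{\rm v}}$, $Y_{\rm h}=\{Y_{i,\rm h}\}_{i\in I_{\rm h}}$ on $\mathbb{R}$, $S_{\rm M}=\bigcup_{i\in I_{\rm h}}(\mathbb{R}\times\{Y_{i,\rm h}\})\cup\bigcup_{j\in I_{\rm v}}(\{Y_{j,\rm v}\}\times\mathbb{R})$. Cells: a cell of a tessellation $S$ is a nonempty connected open set $C\subset\mathbb{R}^2$ with $C\cap S=\emptyset$ and $\partial C\subset S$. Nested tessellation: $S_o$ is one of the basic tessellation processes above, with collection of cells $(C_i)_{i\in J}$. For every $i\in J$, $S_i$ is an independent copy of one of the basic tessellation processes (possibly of a different type or intensity than $S_o$), where all $S_i$ are of the same type and have the same intensity; the $S_i$ are independent of each other and of $S_o$, each based on its own independent underlying point process. Then $S_{\rm N}=S_o\cup\bigcup_{i\in J}(S_i\cap C_i)$. *)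

(* Defs.v *)
From HB Require Import structures.
From mathcomp Require Import all_boot all_order all_algebra.
From mathcomp Require Import all_classical all_reals all_analysis.

Set Implicit Arguments.
Unset Strict Implicit.
Unset Printing Implicit Defensive.

Import Order.TTheory GRing.Theory Num.Theory.
Import numFieldNormedType.Exports.

Local Open Scope classical_set_scope.
Local Open Scope ring_scope.

(* The norm that the library puts on [R * R] is the max norm; it is used here
   only through its topology and its (product) Borel sets. *)
Definition enorm (R : realType) (x : R * R) : R :=
  Num.sqrt (x.1 ^+ 2 + x.2 ^+ 2).

Definition B1 (R : realType) : set (R * R) := [set x | enorm x <= 1].

Definition boundary (T : topologicalType) (A : set T) : set T :=
  closure A `\` interior A.

(* The point 0 makes the diameter of the empty set equal to 0. *)
Definition ediam (R : realType) (U : set (R * R)) : \bar R :=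
  ereal_sup (0%E |` [set (enorm (p.1 - p.2))%:E | p in U `*` U]).

Definition hausdorff1_pre (R : realType) (delta : R) (A : set (R * R)) :
    \bar R :=
  ereal_inf [set (\sum_(0 <= n <oo) ediam (U n))%E |
    U in [set U : nat -> set (R * R) |
      A `<=` \bigcup_n U n /\ forall n, (ediam (U n) <= delta%:E)%E]].

Definition hausdorff1 (R : realType) (A : set (R * R)) : \bar R :=
  ereal_sup [set hausdorff1_pre delta A | delta in [set delta : R | 0 < delta]].

(* A configuration of points is a set [I] of indices and a family [x]; the
    value of [x] outside [I] is irrelevant.  The real infima below are over
    sets bounded below by 0, and are only compared with one of their members,
    so the convention for the infimum of the empty set plays no role. *)

Definition inf_dist (R : realType) (I : set nat) (x : nat -> R * R)
    (y : R * R) : R :=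
  inf [set enorm (y - x j) | j in I].

Definition voronoi (R : realType) (I : set nat) (x : nat -> R * R) :
    set (R * R) :=
  \bigcup_(i in I) boundary [set y | enorm (y - x i) = inf_dist I x y].

Definition delaunay (R : realType) (I : set nat) (x : nat -> R * R) :
    set (R * R) :=
  [set z | exists i j : nat, exists s : R,
    [/\ I i, I j, 0 <= s <= 1,
        z = s *: x i + (1 - s) *: x j
      & exists2 y, voronoi I x y &
          enorm (y - x i) = enorm (y - x j) /\
          enorm (y - x j) = inf_dist I x y]].

Definition line_tess (R : realType) (I : set nat) (x : nat -> R * R) :
    set (R * R) :=
  \bigcup_(i in [set i | I i /\ 0 <= (x i).2 < pi])
    [set y | y.1 * cos (x i).2 + y.2 * sin (x i).2 = (x i).1].

Definition dJ (R : realType) (p q : (R * R) * R) : R :=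
  enorm (p.1 - q.1) + `|q.2 - p.2|.

Definition johnson_mehl (R : realType) (I : set nat) (x : nat -> R * R)
    (t : nat -> R) : set (R * R) :=
  \bigcup_(i in I) boundary
    [set y | dJ (y, 0) (x i, t i) = inf [set dJ (y, 0) (x j, t j) | j in I]].

Definition manhattan (R : realType) (Ih : set nat) (yh : nat -> R)
    (Iv : set nat) (yv : nat -> R) : set (R * R) :=
  \bigcup_(i in Ih) [set z | z.2 = yh i] `|`
  \bigcup_(j in Iv) [set z | z.1 = yv j].

Definition is_cell (R : realType) (S C : set (R * R)) : Prop :=
  [/\ C !=set0, connected C, open C, C `&` S = set0 & boundary C `<=` S].

Definition mutually_independent d (Omega : measurableType d) (R : realType)
    (P : probability Omega R) (I : eqType) (F : I -> set (set Omega)) : Prop :=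
  forall (s : seq I) (A : I -> set Omega), uniq s ->
    (forall i, i \in s -> F i (A i)) ->
    P (\bigcap_(i in [set` s]) A i) = (\prod_(i <- s) P (A i))%E.

Definition exp_moment d (Omega : measurableType d) (R : realType)
    (P : probability Omega R) (Y : Omega -> \bar R) (alpha : R) : \bar R :=
  (\int[P]_w expeR (alpha%:E * Y w))%E.

(* The random family (X_i)_{i in I} of points of E: at [w] the index set is
   [idx X w], and only the points [pt X n w] with [idx X w n] are present.
   Points may coincide, and there may be finitely or infinitely many. *)
Record point_family d (Omega : measurableType d) dE (E : measurableType dE) :=
  PointFamily {
    idx : Omega -> set nat;
    pt : nat -> Omega -> E;
    measurable_idx : forall n, measurable [set w | idx w n];
    measurable_pt : forall n, measurable_fun setT (pt n) }.

Definition npts d (Omega : measurableType d) dE (E : measurableType dE)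
    (R : realType) (X : point_family Omega E) (A : set E) (w : Omega) : \bar R :=
  @counting nat R [set n | idx X w n /\ A (pt X n w)].

Definition locally_finite d (Omega : measurableType d) dE
    (E : measurableType dE) (R : realType) (X : point_family Omega E)
    (norm : E -> R) : Prop :=
  forall (w : Omega) (r : R),
    finite_set [set n | idx X w n /\ norm (pt X n w) <= r].

(* The counts (N(A_1 + t), ..., N(A_m + t)) have the same law for all t. *)
Definition stationary d (Omega : measurableType d) dE (E : measurableType dE)
    (R : realType) (P : probability Omega R) (X : point_family Omega E)
    (add : E -> E -> E) : Prop :=
  forall (t : E) (m : nat) (A : 'I_m -> set E) (k : 'I_m -> nat),
    (forall j, measurable (A j)) ->
    P [set w | forall j, npts R X [set add y t | y in A j] w = (k j)%:R%:E] =
    P [set w | forall j, npts R X (A j) w = (k j)%:R%:E].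

Definition simple_points d (Omega : measurableType d) dE
    (E : measurableType dE) (R : realType) (P : probability Omega R)
    (X : point_family Omega E) : Prop :=
  {ae P, forall w, forall i j, idx X w i -> idx X w j ->
    pt X i w = pt X j w -> i = j}.

Definition point_process2 d (Omega : measurableType d) (R : realType)
    (P : probability Omega R) (X : point_family Omega (R * R)%type)
    (lambda : \bar R) : Prop :=
  [/\ locally_finite X (@enorm R),
      stationary P X (fun x y : R * R => x + y)
    & (\int[P]_w npts R X (`[0%R, 1%R] `*` `[0%R, 1%R]) w)%E = lambda].

Definition point_process1 d (Omega : measurableType d) (R : realType)
    (P : probability Omega R) (Y : point_family Omega R)
    (lambda : \bar R) : Prop :=
  [/\ locally_finite Y (fun y : R => `|y|),
      stationary P Y (fun x y : R => x + y)
    & (\int[P]_w npts R Y `[0%R, 1%R] w)%E = lambda].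

Definition sigma_counts d (Omega : measurableType d) dE (E : measurableType dE)
    (R : realType) (X : point_family Omega E) : set (set Omega) :=
  <<s [set B | exists A (k : nat), measurable A /\
         B = [set w | npts R X A w = k%:R%:E]] >>.

Definition sigma_points d (Omega : measurableType d) dE (E : measurableType dE)
    (X : point_family Omega E) : set (set Omega) :=
  <<s [set B | exists n, B = [set w | idx X w n]] `|`
      [set B | exists n A, measurable A /\ B = pt X n @^-1` A] >>.

(* Here independence is from the enumerated family and not only from the point
   counts: an enumeration that depended on the marks (say, by increasing mark)
   would not give an i.i.d. marked process. *)
Definition iid_marks d (Omega : measurableType d) (R : realType)
    (P : probability Omega R) (X : point_family Omega (R * R)%type)
    (T : nat -> Omega -> R) (mu : probability R R) : Prop :=
  [/\ forall n w, 0 <= T n w,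
      forall n, measurable_fun setT (T n),
      forall n A, measurable A -> P (T n @^-1` A) = mu A
    & mutually_independent P (fun o : option nat =>
        if o is Some n then preimage_set_system setT (T n) measurable
        else sigma_points X)].

(* The sigma-algebra of random closed set theory: it is generated by the
   events "S hits K", with K compact. *)
Definition hit_algebra (R : realType) : set (set (set (R * R))) :=
  <<s [set B | exists2 K : set (R * R), compact K &
         B = [set S | S `&` K !=set0]] >>.

Definition sigma_set (Omega : Type) (R : realType) (S : Omega -> set (R * R)) :
    set (set Omega) :=
  preimage_set_system setT S (hit_algebra (R := R)).

Definition random_set d (Omega : measurableType d) (R : realType)
    (S : Omega -> set (R * R)) : Prop :=
  forall B, sigma_set S B -> measurable B.

Definition same_law d (Omega : measurableType d) (R : realType)
    (P : probability Omega R) (S1 S2 : Omega -> set (R * R)) : Prop :=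
  forall B, hit_algebra B -> P (S1 @^-1` B) = P (S2 @^-1` B).

(* Type and parameters of a basic tessellation process.  The intensities of the
   two processes of a Manhattan grid (horizontal, vertical) are unrestricted. *)
Inductive tess_type (R : realType) : Type :=
| Voronoi of R
| Delaunay of R
| Line of R
| JohnsonMehl of R & probability R R
| Manhattan of \bar R & \bar R.

Definition tess_from d (Omega : measurableType d) (R : realType)
    (P : probability Omega R) (tau : tess_type R) (S : Omega -> set (R * R)) :
    Prop :=
  match tau with
  | Voronoi lambda => 0 < lambda /\ exists X,
      point_process2 P X lambda%:E /\
      S = fun w => voronoi (idx X w) (pt X ^~ w)
  | Delaunay lambda => 0 < lambda /\ exists X,
      point_process2 P X lambda%:E /\
      S = fun w => delaunay (idx X w) (pt X ^~ w)
  | Line lambda => 0 < lambda /\ exists X,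
      point_process2 P X lambda%:E /\
      S = fun w => line_tess (idx X w) (pt X ^~ w)
  | JohnsonMehl lambda mu => 0 < lambda /\ mu `<< lebesgue_measure /\
      exists X T, [/\ point_process2 P X lambda%:E, iid_marks P X T mu &
        S = fun w => johnson_mehl (idx X w) (pt X ^~ w) (T ^~ w)]
  | Manhattan lambdah lambdav => exists Yh Yv,
      [/\ point_process1 P Yh lambdah /\ simple_points P Yh,
          point_process1 P Yv lambdav /\ simple_points P Yv,
          mutually_independent P (fun b : bool =>
            sigma_counts R (if b then Yh else Yv)) &
        S = fun w => manhattan (idx Yh w) (pt Yh ^~ w) (idx Yv w) (pt Yv ^~ w)]
  end.

Definition basic_tessellation d (Omega : measurableType d) (R : realType)
    (P : probability Omega R) (tau : tess_type R) (S : Omega -> set (R * R)) :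
    Prop :=
  random_set S /\ tess_from P tau S.

(* [C w] restricted to [J w] lists every cell of [S w] exactly once, and each
   C_i is a random open set. *)
Definition cell_enumeration d (Omega : measurableType d) (R : realType)
    (S : Omega -> set (R * R)) (J : Omega -> set nat)
    (C : Omega -> nat -> set (R * R)) : Prop :=
  (forall w, set_bij (J w) [set A | is_cell (S w) A] (C w)) /\
  (forall i (G : set (R * R)), open G ->
     measurable [set w | J w i /\ C w i `&` G !=set0]).

(* The labels of the cells may be random beyond S_o (e.g. labels of the points
   of a Voronoi tessellation), so they belong to the first layer with S_o. *)
Definition sigma_first_layer (Omega : Type) (R : realType)
    (So : Omega -> set (R * R)) (J : Omega -> set nat)
    (C : Omega -> nat -> set (R * R)) : set (set Omega) :=
  <<s sigma_set So `|`
      [set B | exists i (G : set (R * R)), open G /\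
         B = [set w | J w i /\ C w i `&` G !=set0]] >>.

Definition nested (Omega : Type) (R : realType) (So : Omega -> set (R * R))
    (J : Omega -> set nat) (C : Omega -> nat -> set (R * R))
    (S : nat -> Omega -> set (R * R)) (w : Omega) : set (R * R) :=
  So w `|` \bigcup_(i in J w) (S i w `&` C w i).

Definition ncells_B1 (Omega : Type) (R : realType) (J : Omega -> set nat)
    (C : Omega -> nat -> set (R * R)) (w : Omega) : \bar R :=
  @counting nat R [set i | J w i /\ C w i `&` B1 (R := R) !=set0].

Definition edge_length (Omega : Type) (R : realType)
    (S : Omega -> set (R * R)) (A : set (R * R)) (w : Omega) : \bar R :=
  hausdorff1 (S w `&` A).

(* Main.v *)
From HB Require Import structures.
Require Import Defs.
From mathcomp Require Import all_boot all_order all_algebra.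
From mathcomp Require Import all_classical all_reals all_analysis.
From mathcomp Require Import ring lra measurable_realfun.

(** By the hypotheses on the number [V] of cells of [So] that meet the disk
    [B1], it is finite almost surely. The edges of the nested tessellation in
    [B1] are covered by those of [So] and by those of the [V] tessellations [S
    i] attached to these cells. Two facts give the theorem.

    First, the edges of [So] in [B1] have length at most [16 + 16 V] almost
    surely, so that the moments of [V] control the first layer. Second, given
    the set of cells that meet the disk, the [V] lengths of the second layer
    are independent and each has an exponential moment at most [m alpha],
    where [m alpha] depends on the law of [S'] only. Hence the moment of order
    [alpha] of the nested tessellation is at most the expectation of [exp (16
    alpha + beta V)] with [beta = 16 alpha + ln (m alpha)]. This is finite for
    each [alpha > 0] in part (i), and moments of order at most 0 are finite
    anyway. In part (ii), convexity of the exponential gives [m (t alpha) <= 1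
    + t q] for a constant [q] and [t] in [[0, 1]], so [beta] tends to 0 with
    [t].

    The bound of the first layer ([tame_length_bound]) is local. Apart from
    finitely many points in the disk, each edge point [x] lies on the boundary
    of a region [A] whose boundary consists of edges and which has a
    supporting line at [x]. A cell that meets the interior of [A] near [x]
    stays inside [A], hence also has a supporting line at [x]. The points of
    the closure of a given set at which it has a supporting line with normal
    in a given quadrant form a staircase, and a staircase in the disk has
    length at most 4 ([length_bound_staircase]); the four quadrants give 16
    for each cell. The region [A] is a half-plane for lines and grids. For
    Voronoi and Johnson--Mehl tessellations, [A] is the region of that one of
    the two nuclei which appears later: the hyperbola between two nuclei bends
    around the later one. For Delaunay tessellations, [A] is a triangle,
    obtained by sliding the centre of an empty disk along the bisector of an
    edge until the disk hits a third point. Two kinds of degenerate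
    configurations have probability zero. A Johnson--Mehl nucleus may be
    reached by the growth of another one exactly at its birth; this is
    excluded by the diffuse law of the marks ([ae_nondegenerate]). A Delaunay
    configuration may leave a quadrant empty; by stationarity it is then empty
    altogether ([ae_spread]).

    The length of [S w] in [B1] is a supremum of infima over uncountable
    families of covers, so its measurability in [w] is not obvious, and the
    exponential moments are only lower integrals. The length is therefore
    replaced by a discrete quantity: [short k] says that finitely many small
    rational squares of total radius less than [k] cover the edges in the
    disk. This depends only on which compact sets are missed. It bounds the
    length by [4 k] for every set, and by compactness it holds for each closed
    set of length less than [k] ([hausdorff1_short]); the factor 4 is harmless
    in both parts. Independence of events then suffices to compute the
    expectations ([integral_independent]). *)

Set Implicit Arguments.
Unset Strict Implicit.
Unset Printing Implicit Defensive.

Import Order.TTheory GRing.Theory Num.Theory.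
Import numFieldNormedType.Exports.

Local Open Scope classical_set_scope.
Local Open Scope ring_scope.

(** * The Euclidean plane *)

Section Plane.
Variable R : realType.
Local Notation plane := (R * R)%type.
Implicit Types (x y z p q u v n : plane) (A B S : set plane).

Definition dot u v : R := u.1 * v.1 + u.2 * v.2.

Lemma fstD u v : (u + v).1 = u.1 + v.1. Proof. by []. Qed.
Lemma sndD u v : (u + v).2 = u.2 + v.2. Proof. by []. Qed.
Lemma fstN u : (- u).1 = - u.1. Proof. by []. Qed.
Lemma sndN u : (- u).2 = - u.2. Proof. by []. Qed.
Lemma fstZ (s : R) u : (s *: u).1 = s * u.1. Proof. by []. Qed.
Lemma sndZ (s : R) u : (s *: u).2 = s * u.2. Proof. by []. Qed.
(** Rewrite rules that expose coordinates to the ring tactics; simplification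
    alone does not always open the operations on pairs. *)
Definition coordE := (fstD, sndD, fstN, sndN, fstZ, sndZ).

Lemma plane_eq u v : u.1 = v.1 -> u.2 = v.2 -> u = v.
Proof. by case: u v => [a b] [c d] /= -> ->. Qed.

Lemma dotC u v : dot u v = dot v u.
Proof. by rewrite /dot mulrC [u.2 * _]mulrC. Qed.

Lemma dotDr u v w : dot u (v + w) = dot u v + dot u w.
Proof. by rewrite /dot !coordE; ring. Qed.

Lemma dotBr u v w : dot u (v - w) = dot u v - dot u w.
Proof. by rewrite /dot !coordE; ring. Qed.

Lemma dotZr u (s : R) v : dot u (s *: v) = s * dot u v.
Proof. by rewrite /dot !coordE; ring. Qed.

Lemma dotBl u v w : dot (v - w) u = dot v u - dot w u.
Proof. by rewrite /dot !coordE; ring. Qed.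

Lemma dotZl u (s : R) v : dot (s *: v) u = s * dot v u.
Proof. by rewrite /dot !coordE; ring. Qed.

Lemma dotNr u v : dot u (- v) = - dot u v.
Proof. by rewrite /dot !coordE; ring. Qed.

Lemma dot_ge0 u : 0 <= dot u u.
Proof. by rewrite addr_ge0 // -expr2 sqr_ge0. Qed.

Lemma dot_gt0 u : u != 0 -> 0 < dot u u.
Proof.
move=> u0; rewrite lt_neqAle dot_ge0 andbT eq_sym.
apply: contra u0; rewrite /dot paddr_eq0 -?expr2 ?sqr_ge0 // !sqrf_eq0.
by case: u => a b /= /andP[/eqP -> /eqP ->].
Qed.

Lemma enorm_sqr u : enorm u ^+ 2 = dot u u.
Proof. by rewrite sqr_sqrtr ?addr_ge0 ?sqr_ge0. Qed.

Lemma enorm_ge0 u : 0 <= enorm u. Proof. exact: sqrtr_ge0. Qed.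

Lemma enormN u : enorm (- u) = enorm u.
Proof. by rewrite /enorm !coordE !sqrrN. Qed.

Lemma enormC u v : enorm (u - v) = enorm (v - u).
Proof. by rewrite -enormN opprB. Qed.

Lemma enorm0 : enorm (0 : plane) = 0.
Proof. by rewrite /enorm /= expr0n /= addr0 sqrtr0. Qed.

Lemma enormZ (s : R) u : enorm (s *: u) = `|s| * enorm u.
Proof.
by rewrite /enorm !coordE !exprMn -mulrDr sqrtrM ?sqr_ge0 // sqrtr_sqr.
Qed.

Lemma le_enorm u v : (enorm u <= enorm v) = (dot u u <= dot v v).
Proof. by rewrite -!enorm_sqr ler_pXn2r ?nnegrE ?enorm_ge0. Qed.

Lemma dot_le u v : dot u v <= enorm u * enorm v.
Proof.
have [d0|d0] := ltP (dot u v) 0.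
  by apply: ltW; apply: lt_le_trans d0 _; rewrite mulr_ge0 ?enorm_ge0.
rewrite -(@ler_pXn2r _ 2) ?nnegrE ?mulr_ge0 ?enorm_ge0 //.
rewrite exprMn !enorm_sqr -subr_ge0.
have -> : dot u u * dot v v - dot u v ^+ 2 = (u.1 * v.2 - u.2 * v.1) ^+ 2.
  by rewrite /dot; ring.
exact: sqr_ge0.
Qed.

Lemma enormD u v : enorm (u + v) <= enorm u + enorm v.
Proof.
rewrite -(@ler_pXn2r _ 2) ?nnegrE ?addr_ge0 ?enorm_ge0 // sqrrD !enorm_sqr.
have -> : dot (u + v) (u + v) = dot u u + dot u v *+ 2 + dot v v.
  by rewrite /dot !coordE; ring.
by rewrite lerD2r lerD2l lerMn2r /= dot_le.
Qed.

Lemma enorm_tri x y z : enorm (x - z) <= enorm (x - y) + enorm (y - z).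
Proof. by rewrite -[x - z](subrKA y) enormD. Qed.

Lemma enorm_le_l1 u : enorm u <= `|u.1| + `|u.2|.
Proof.
rewrite -(@ler_pXn2r _ 2) ?nnegrE ?addr_ge0 ?enorm_ge0 // enorm_sqr /dot.
rewrite sqrrD !real_normK ?num_real // -!expr2 lerD2r lerDl mulrn_wge0 //.
Qed.

Lemma norm1_le_enorm u : `|u.1| <= enorm u.
Proof. by rewrite -sqrtr_sqr ler_wsqrtr // lerDl sqr_ge0. Qed.

Lemma norm2_le_enorm u : `|u.2| <= enorm u.
Proof. by rewrite -sqrtr_sqr ler_wsqrtr // lerDr sqr_ge0. Qed.

Lemma enorm_eq0 u : enorm u = 0 -> u = 0.
Proof.
move=> u0; case: (eqVneq u 0) => // /dot_gt0.
by rewrite -enorm_sqr u0 expr0n /= ltxx.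
Qed.

Lemma fst_cts : continuous (fun y : plane => y.1).
Proof. by move=> y; exact: cvg_fst. Qed.

Lemma snd_cts : continuous (fun y : plane => y.2).
Proof. by move=> y; exact: cvg_snd. Qed.

Lemma dot_cts n : continuous (dot n).
Proof.
by move=> y; apply: cvgD; apply: cvgM; [exact: cvg_cst|exact: fst_cts|
  exact: cvg_cst|exact: snd_cts].
Qed.

Lemma dotsub_cts n x : continuous (fun y => dot n (y - x)).
Proof.
have -> : (fun y => dot n (y - x)) = (fun y => dot n y - dot n x).
  by apply/funext => y; rewrite dotBr.
by move=> y; apply: cvgB; [exact: dot_cts|exact: cvg_cst].
Qed.

Lemma enorm_cts p : continuous (fun y => enorm (y - p)).
Proof.
move=> y.
apply: (@continuous_comp _ _ _ (fun y : plane => (y - p).1 ^+ 2 + (y - p).2 ^+ 2)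
  (@Num.sqrt R)); last exact: sqrt_continuous.
have H : forall f : plane -> R, continuous f -> continuous (fun z => f z ^+ 2).
  by move=> f cf z; rewrite /= (_ : (fun z => f z ^+ 2) = (fun z => f z * f z));
     [apply: cvgM; exact: cf|apply/funext => w; rewrite expr2].
have c1 : continuous (fun z : plane => (z - p).1).
  by move=> z; apply: cvgB; [exact: fst_cts|exact: cvg_cst].
have c2 : continuous (fun z : plane => (z - p).2).
  by move=> z; apply: cvgB; [exact: snd_cts|exact: cvg_cst].
by apply: cvgD; [exact: (H _ c1)|exact: (H _ c2)].
Qed.

Lemma enorm_cts0 : continuous (@enorm R).
Proof.
have -> : @enorm R = (fun y => enorm (y - 0)) by apply/funext => y; rewrite subr0.
exact: enorm_cts.
Qed.

Lemma line_cts x u : continuous (fun s : R => x + s *: u).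
Proof.
move=> s; apply: cvgD; first exact: cvg_cst.
by apply: cvgZr_tmp; exact: cvg_id.
Qed.

Lemma open_lt_cts (f : plane -> R) c : continuous f -> open [set y | f y < c].
Proof.
move=> cf; apply: (open_comp (D := [set r | r < c])) => [y _|].
  exact: cf.
exact: open_lt.
Qed.

Lemma open_gt_cts (f : plane -> R) c : continuous f -> open [set y | c < f y].
Proof.
move=> cf; apply: (open_comp (D := [set r | c < r])) => [y _|].
  exact: cf.
exact: open_gt.
Qed.

Lemma closed_le_cts (f : plane -> R) c : continuous f -> closed [set y | f y <= c].
Proof.
move=> cf; apply: (preimage_closed (D := [set r | r <= c])) => [y _|].
  exact: cf.
exact: closed_le.
Qed.

Lemma closed_ge_cts (f : plane -> R) c : continuous f -> closed [set y | c <= f y].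
Proof.
move=> cf; apply: (preimage_closed (D := [set r | c <= r])) => [y _|].
  exact: cf.
exact: closed_ge.
Qed.

Lemma closed_eq_cts (f : plane -> R) c : continuous f -> closed [set y | f y = c].
Proof.
move=> cf; apply: (preimage_closed (D := [set r | r = c])) => [y _|].
  exact: cf.
exact: closed_eq.
Qed.

Lemma closed_B1 : closed (@B1 R).
Proof. apply: closed_le_cts; exact: enorm_cts0. Qed.

(** A point is in the closure of a set as soon as some ray issued from it
    starts inside the set; all the adherence arguments below use such rays. *)
Lemma closure_ray x u A (e : R) : 0 < e ->
  (forall s, 0 < s < e -> A (x + s *: u)) -> closure A x.
Proof.
move=> e0 HA B Bx.
have : nbhs (0 : R) ((fun s : R => x + s *: u) @^-1` B).
  by apply: line_cts; rewrite scale0r addr0.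
case/nbhs_ballP => d /= d0 HB.
pose s := Num.min (d / 2) (e / 2).
have s0 : 0 < s by rewrite lt_min !divr_gt0.
exists (x + s *: u); split.
  apply: HA; rewrite s0 /= gt_min; apply/orP; right.
  by rewrite ltr_pdivrMr // ltr_pMr // ltr1n.
apply: HB; rewrite /ball /= sub0r normrN gtr0_norm // gt_min.
by rewrite ltr_pdivrMr // ltr_pMr // ltr1n.
Qed.

Lemma closure_fin (K : choiceType) (I : set K) (F : K -> set plane) x :
  finite_set I -> closure (\bigcup_(i in I) F i) x ->
  exists2 i, I i & closure (F i) x.
Proof.
move=> fI cx.
have cl : closed (\bigcup_(i in I) closure (F i)).
  by apply: closed_bigcup => // i _; exact: closed_closure.
have := closureS (fun z => _ : (\bigcup_(i in I) F i) z ->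
  (\bigcup_(i in I) closure (F i)) z).
move=> /(_ _ x cx); rewrite -(closure_id _).1 //.
by case=> [z [i Ii Fz]|i Ii Fx]; exists i => //; exact: subset_closure.
Qed.

(** A connected set that avoids the frontier of [A] lies on one side of it,
    because its trace on [A] is both open and closed. *)
Lemma connected_side C A : connected C -> C `&` boundary A = set0 ->
  C `&` A !=set0 -> C `<=` A.
Proof.
move=> cC CA [z [Cz Az]].
suff <- : C `&` A = C by move=> y [].
apply: cC; first by exists z.
  exists A°; first exact: open_interior.
  rewrite eqEsubset; split=> y [Cy Ay]; split=> //; last exact: interior_subset.
  apply: contrapT => nA; suff : (C `&` boundary A) y by rewrite CA.
  by split=> //; split=> //; exact: subset_closure.
exists (closure A); first exact: closed_closure.
rewrite eqEsubset; split=> y [Cy Ay]; split=> //; first exact: subset_closure.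
apply: contrapT => nA; suff : (C `&` boundary A) y by rewrite CA.
by split=> //; split=> // /interior_subset.
Qed.

Section LocFin.
Variables (K : choiceType) (I : set K) (F : K -> set plane).
Hypothesis cF : forall i, I i -> closed (F i).
Hypothesis lfF : forall r, finite_set [set i | I i /\ exists2 y, F i y & enorm y <= r].

(** Near a given point only finitely many members of the family matter, and the
    closure of a finite union is the union of the closures. *)
Lemma locfin_closure x : closure (\bigcup_(i in I) F i) x ->
  exists2 i, I i & closure (F i) x.
Proof.
move=> cx; set r := enorm x + 1.
have : closure (\bigcup_(i in [set i | I i /\ exists2 y, F i y & enorm y <= r]) F i) x.
  move=> B Bx.
  have Ox : nbhs x [set y | enorm y < r].
    apply: open_nbhs_nbhs; split; last by rewrite /= ltrDl.
    by apply: open_lt_cts; exact: enorm_cts0.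
  have [y [[i Ii Fy] [By ry]]] := cx _ (filterI Bx Ox).
  by exists y; split=> //; exists i => //; split=> //; exists y => //; exact: ltW.
by move=> /(closure_fin (lfF r)) [i [Ii _] ?]; exists i.
Qed.

Lemma locfin_closed : closed (\bigcup_(i in I) F i).
Proof.
move=> x /locfin_closure[i Ii]; rewrite -(closure_id _).1 //; last exact: cF.
by move=> Fx; exists i.
Qed.

Hypothesis iF : forall i, I i -> (F i)° = set0.

(** The members can be removed from a bounded open set one at a time: each
    removal leaves a nonempty open set. *)
Lemma locfin_dense : dense (~` \bigcup_(i in I) F i).
Proof.
suff H : forall (s : seq K) (O : set plane), O !=set0 -> open O -> {subset s <= I} ->
    exists W, [/\ W !=set0, open W, W `<=` O & forall i, i \in s -> W `&` F i = set0].
  move=> O [x Ox] oO; set r := enorm x + 1.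
  pose O1 := O `&` [set y | enorm y < r].
  have oO1 : open O1 by apply: openI => //; apply: open_lt_cts; exact: enorm_cts0.
  have O1x : O1 x by split=> //; rewrite /= ltrDl.
  have [X XE] := ((finite_seqP _).1 (lfF r)).
  have sX : {subset X <= I}.
    move=> i iX; have : [set` X] i by [].
    by rewrite -XE => -[Ii _]; rewrite inE.
  have [W [W0 oW WO HW]] := H _ _ (ex_intro _ x O1x) oO1 sX.
  have [y Wy] := W0; exists y; split; first by case: (WO _ Wy).
  move=> -[i Ii Fy].
  have : [set` X] i by rewrite -XE; split=> //; exists y => //;
    case: (WO _ Wy) => _ /ltW.
  by move=> /HW; rewrite -subset0 => /(_ y); apply.
elim=> [|i s IH] O O0 oO sI; first by exists O; split.
have [|W [W0 oW WO HW]] := IH O O0 oO.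
  by move=> j js; apply: sI; rewrite inE js orbT.
have Ii : I i by have := sI i; rewrite !inE eqxx => /(_ isT).
exists (W `\` F i); split.
- apply: contrapT => /set0P/negP; rewrite negbK => /eqP E.
  case: W0 => y Wy; suff : (F i)° y by rewrite iF.
  have : W `<=` F i.
    by move=> z Wz; apply: contrapT => nF; have : (W `\` F i) z by []; rewrite E.
  by rewrite (open_subsetE _ oW); exact.
- by apply: openI => //; apply: closed_openC; exact: cF.
- by move=> y [/WO].
- move=> j; rewrite inE => /orP[/eqP ->|/HW].
    by rewrite setDE -setIA setICl setI0.
  by rewrite -!subset0 => H y [[Wy _] Fy]; exact: (H y).
Qed.
End LocFin.

Lemma line_interior0 (n : plane) (b : R) : n != 0 -> [set y | dot n y = b]° = set0.
Proof.
move=> n0; rewrite -subset0 => x xi.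
have : closure (~` [set y | dot n y = b]) x.
  apply: (@closure_ray _ n _ 1) => // s /andP[s0 _] /=.
  have := interior_subset xi; rewrite /= dotDr dotZr => ->.
  have := mulr_gt0 s0 (dot_gt0 n0); lra.
by rewrite closure_setC; exact.
Qed.

Lemma closed_line (n : plane) (b : R) : closed [set y | dot n y = b].
Proof. by apply: closed_eq_cts; exact: dot_cts. Qed.

Lemma boundary_interior0 A : closed A -> (boundary A)° = set0.
Proof.
move=> cA; rewrite -subset0 => x /= xb.
have [_] := interior_subset xb; apply.
apply: filterS xb => y [+ _]; by rewrite -(closure_id _).1.
Qed.

Lemma closed_boundary A : closed (boundary A).
Proof.
apply: closedI; first exact: closed_closure.
by apply: open_closedC; exact: open_interior.
Qed.

Definition segment (p q : plane) : set plane :=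
  [set z | exists2 s : R, 0 <= s <= 1 & z = s *: p + (1 - s) *: q].

Lemma connected_segment p q : connected (segment p q).
Proof.
have -> : segment p q = (fun s => q + s *: (p - q)) @` `[0, 1].
  rewrite eqEsubset; split=> z [s s01]; last move=> <-.
    move=> ->; exists s; rewrite /= ?in_itv //=.
    by rewrite scalerBr scalerBl scale1r addrCA addrA.
  exists s; first by move: s01; rewrite /= in_itv.
  by rewrite scalerBr scalerBl scale1r addrCA addrA.
apply: connected_continuous_connected.
  by apply/connected_intervalP; exact: interval_is_interval.
by apply: continuous_subspaceT; exact: line_cts.
Qed.

Lemma closed_segment p q : closed (segment p q).
Proof.
have -> : segment p q = (fun s => q + s *: (p - q)) @` `[0, 1].
  rewrite eqEsubset; split=> z [s s01]; last move=> <-.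
    move=> ->; exists s; rewrite /= ?in_itv //=.
    by rewrite scalerBr scalerBl scale1r addrCA addrA.
  exists s; first by move: s01; rewrite /= in_itv.
  by rewrite scalerBr scalerBl scale1r addrCA addrA.
apply: compact_closed; first exact: norm_hausdorff.
apply: continuous_compact; last exact: segment_compact.
by apply: continuous_subspaceT; exact: line_cts.
Qed.

Lemma nbhs_enorm x A : nbhs x A ->
  exists2 e : R, 0 < e & forall y, enorm (y - x) < e -> A y.
Proof.
case/nbhs_ballP => e /= e0 H; exists e => // y ye; apply: H; split=> /=.
- rewrite /ball /= distrC; apply: le_lt_trans ye; exact: (norm1_le_enorm (y - x)).
- rewrite /ball /= distrC; apply: le_lt_trans ye; exact: (norm2_le_enorm (y - x)).
Qed.

Lemma enorm_nbhs x (e : R) : 0 < e -> nbhs x [set y | enorm (y - x) < e].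
Proof.
move=> e0; apply: open_nbhs_nbhs; split; last by rewrite /= subrr enorm0.
by apply: open_lt_cts; exact: enorm_cts.
Qed.

(** The cell is the connected component of the point. Disks are connected, so
    components of open sets are open, and a boundary point of a component off
    [S] would be joined to it by a segment. *)
Lemma exists_cell S z : closed S -> ~ S z ->
  exists2 C, is_cell S C & C z.
Proof.
move=> cS Sz; set C := connected_component (~` S) z.
have Cz : C z by exact: connected_component_refl.
have CS : C `<=` ~` S by exact: connected_component_sub.
(* Two points of a disk that avoids [S] belong to the same component. *)
have seg y e : (forall u, enorm (u - y) < e -> ~ S u) -> forall v, C v ->
    enorm (v - y) < e -> forall u, enorm (u - y) < e -> C u.
  move=> HS v Cv vy u uy.
  have CE : C = connected_component (~` S) v by exact: same_connected_component.
  rewrite CE; exists (segment u v); last by exists 1;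
    rewrite ?subrr ?scale0r ?addr0 ?scale1r ?ler01 ?lexx.
  split; [|move=> w [s /andP[s0 s1] ->]|exact: connected_segment].
    by exists 0; rewrite ?subr0 ?scale0r ?add0r ?scale1r ?ler01 ?lexx.
  apply: HS.
  have -> : s *: u + (1 - s) *: v - y = s *: (u - y) + (1 - s) *: (v - y).
    by congr pair => /=; rewrite /GRing.scale /=; ring.
  apply: le_lt_trans (enormD _ _) _; rewrite !enormZ !ger0_norm ?subr_ge0 //.
  have [->|sn] := eqVneq s 0; first by rewrite subr0 mul0r add0r mul1r.
  have sp : 0 < s by rewrite lt_neqAle eq_sym sn.
  have := enorm_ge0 (v - y); nra.
have oS : open (~` S) by exact: closed_openC.
exists C => //; split.
- by exists z.
- exact: component_connected.
- rewrite openE => y Cy; have : nbhs y (~` S) by apply: open_nbhs_nbhs;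
  split => //; exact: CS.
  case/nbhs_enorm => e e0 He; apply: filterS (enorm_nbhs y e0) => u uy.
  by apply: (seg y e _ y) => //; rewrite subrr enorm0.
- by rewrite -subset0 => y [/CS].
- move=> y [cy iy]; apply: contrapT => Sy; apply: iy.
  have : nbhs y (~` S) by apply: open_nbhs_nbhs.
  case/nbhs_enorm => e e0 He.
  have [v [Cv vy]] := cy _ (enorm_nbhs y e0).
  by apply: filterS (enorm_nbhs y e0) => u uy; exact: (seg y e _ v).
Qed.

End Plane.

(** * Sets of bounded length, and sets with supporting lines *)

Section Covers.
Variable R : realType.
Local Notation plane := (R * R)%type.
Implicit Types (x y z p q : plane) (A B S : set plane).

(** The second components are upper bounds of the diameters rather than the
    diameters, and the covers are finite: this makes the additivity of lengths
    elementary. *)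
Definition small_cover (delta c : R) A := exists s : seq (set plane * R),
  [/\ A `<=` [set p | exists2 u, u \in s & u.1 p],
      forall u, u \in s -> 0 <= u.2 <= delta,
      forall u p q, u \in s -> u.1 p -> u.1 q -> enorm (p - q) <= u.2 &
      \sum_(u <- s) u.2 <= c].

(** Stronger than a bound on the Hausdorff measure, because the covers are
    finite. *)
Definition length_bound A (c : R) := forall delta, 0 < delta -> small_cover delta c A.

Lemma length_boundS A B a b : A `<=` B -> b <= a -> length_bound B b ->
  length_bound A a.
Proof.
move=> AB ba cB e e0; have [s [h1 h2 h3 h4]] := cB e e0.
by exists s; split=> //; [exact: subset_trans h1|exact: le_trans ba].
Qed.

Lemma length_boundU A B a b : length_bound A a -> length_bound B b ->
  length_bound (A `|` B) (a + b).
Proof.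
move=> cA cB e e0; have [s [h1 h2 h3 h4]] := cA e e0.
have [t [k1 k2 k3 k4]] := cB e e0; exists (s ++ t); split.
- move=> p [/h1|/k1] [u us up]; exists u => //; rewrite mem_cat us ?orbT //.
- by move=> u; rewrite mem_cat => /orP[/h2|/k2].
- by move=> u p q; rewrite mem_cat => /orP[/h3|/k3]; apply.
- by rewrite big_cat lerD.
Qed.

Lemma length_bound_bigcup (K : eqType) (s : seq K) (F : K -> set plane) (c : K -> R) :
  (forall i, i \in s -> length_bound (F i) (c i)) ->
  length_bound [set p | exists2 i, i \in s & F i p] (\sum_(i <- s) c i).
Proof.
elim: s => [|i s IH] H.
  by move=> e e0; exists [::]; rewrite !big_nil; split=> // p [].
have Hs j : j \in s -> length_bound (F j) (c j) by move=> js; apply: H;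
  rewrite inE js orbT.
rewrite big_cons; apply: length_boundS (lexx _) (length_boundU (H i
  (mem_head _ _)) (IH Hs)).
by move=> p [j]; rewrite inE => /orP[/eqP ->|js] Fj; [left|right; exists j].
Qed.

Lemma length_bound_finite A : finite_set A -> length_bound A 0.
Proof.
move=> /finite_seqP[s ->] e e0; exists [seq ([set p], 0) | p <- s]; split.
- by move=> p /= ps; exists ([set p], 0) => //; exact: map_f.
- by move=> u /mapP[p _ ->] /=; rewrite lexx ltW.
- by move=> u p q /mapP[r _ ->] /= -> ->; rewrite subrr enorm0.
- by rewrite big_map big1.
Qed.

(** The inverse of an expanding function is 1-Lipschitz, so cutting the range
    [[-2, 2]] into small intervals cuts [A] into pieces of the same size. *)
Lemma length_bound_expanding A (phi : plane -> R) :
  (forall p, A p -> `|phi p| < 2) ->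
  (forall p q, A p -> A q -> enorm (p - q) <= `|phi p - phi q|) ->
  length_bound A 4.
Proof.
move=> b2 ex e e0; pose N := (Num.truncn (4 / e)).+1.
have N0 : 0 < N%:R :> R by rewrite ltr0n.
have Ne : 4 / N%:R <= e.
  by rewrite ler_pdivrMr // mulrC -ler_pdivrMr // ltW // truncnS_gt.
pose U k := [set p | A p /\ k%:R <= (phi p + 2) * N%:R / 4 <= k.+1%:R].
exists [seq (U k, 4 / N%:R) | k <- iota 0 N]; split.
- move=> p Ap; pose t := (phi p + 2) * N%:R / 4.
  have /ltr_normlP[] := b2 _ Ap => h1 h2.
  have t0 : 0 <= t by rewrite /t divr_ge0 // mulr_ge0 //; lra.
  have /andP[k1 k2] := truncn_itv t0.
  exists (U (Num.truncn t), 4 / N%:R); last by split=> //; rewrite k1 ltW.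
  apply: map_f; rewrite mem_iota /= add0n -(ltr_nat R); apply: le_lt_trans k1 _.
  rewrite /t ltr_pdivrMr // mulrC ltr_pM2l //; lra.
- by move=> u /mapP[k _ ->] /=; rewrite Ne divr_ge0.
- move=> u p q /mapP[k _ ->] /= [Ap /andP[p1 p2]] [Aq /andP[q1 q2]].
  apply: le_trans (ex _ _ Ap Aq) _.
  rewrite ler_pdivlMr // -[X in _ * X]ger0_norm ?ler0n // -normrM.
  have := p1; have := p2; have := q1; have := q2.
  rewrite !ler_pdivlMr // !ler_pdivrMr // -!natr1 => *.
  rewrite ler_norml; apply/andP; split; lra.
- rewrite big_map big_const_seq count_predT size_iota iter_addr_0 -[_ *+ N]mulr_natl.
  by rewrite mulrCA divff ?mulr1 // gt_eqF.
Qed.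

(** On a monotone staircase the l1-distance is the variation of the difference
    of the (signed) coordinates, and this difference is smaller than 2 in
    absolute value on the unit disk. *)
Lemma length_bound_staircase A (a b : R) : a ^+ 2 = 1 -> b ^+ 2 = 1 ->
  A `<=` @B1 R ->
  (forall p q, A p -> A q -> ~ (0 < a * (q - p).1 /\ 0 < b * (q - p).2)) ->
  length_bound A 4.
Proof.
move=> a1 b1 AB stair.
apply: (@length_bound_expanding _ (fun p => a * p.1 - b * p.2)) => [p /AB|p q Ap Aq].
  rewrite /B1 /= => p1.
  have : p.1 ^+ 2 + p.2 ^+ 2 <= 1.
    by rewrite -[leLHS](@enorm_sqr R p) expr_le1 ?enorm_ge0.
  move=> h; rewrite -(@ltr_pXn2r _ 2) ?nnegrE // real_normK ?num_real //.
  have : 0 <= (a * p.1 + b * p.2) ^+ 2 by exact: sqr_ge0.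
  rewrite !expr2 in a1 b1 h *; nra.
have h1 := stair _ _ Ap Aq; have h2 := stair _ _ Aq Ap.
have aE : a = 1 \/ a = -1.
  by apply/pred2P; rewrite -eqf_sqr expr1n a1.
have bE : b = 1 \/ b = -1.
  by apply/pred2P; rewrite -eqf_sqr expr1n b1.
apply: le_trans (enorm_le_l1 _) _; move: h1 h2.
rewrite -[(q - p).1]/(q.1 - p.1) -[(q - p).2]/(q.2 - p.2).
rewrite -[(p - q).1]/(p.1 - q.1) -[(p - q).2]/(p.2 - q.2).
move: p.1 p.2 q.1 q.2 => p1 p2 q1 q2 h1 h2.
have e1 : (a * (q1 - p1) <= 0) || (b * (q2 - p2) <= 0).
  by rewrite !leNgt -negb_and; apply/negP => /andP[? ?]; apply: h1.
have e2 : (a * (p1 - q1) <= 0) || (b * (p2 - q2) <= 0).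
  by rewrite !leNgt -negb_and; apply/negP => /andP[? ?]; apply: h2.
move: e1 e2 {h1 h2}; case: aE => ->; case: bE => -> e1 e2;
do 3 (case: ler0P => ? //); case/orP: e1; case/orP: e2; lra.
Qed.

(** The line through [x] with outer normal [n] is a supporting line of [A]. *)
Definition supported A x := exists2 n : plane, n != 0 & forall y, A y ->
  dot n (y - x) <= 0.

(** The points whose normal lies in a given closed quadrant form a staircase:
    two of them cannot differ by a vector of the open quadrant, since the
    normal at the first would have a positive product with it. *)
Lemma length_bound_supported A :
  length_bound [set x | [/\ closure A x, B1 x & supported A x]] 16.
Proof.
pose Q (ab : R * R) := [set x | [/\ closure A x, B1 x & exists n : plane,
  [/\ n != 0, 0 <= ab.1 * n.1, 0 <= ab.2 * n.2 & forall y, A y -> dot n (y - x) <= 0]]].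
have QP ab : ab.1 ^+ 2 = 1 -> ab.2 ^+ 2 = 1 -> length_bound (Q ab) 4.
  case: ab => a b /= a1 b1; apply: (length_bound_staircase a1 b1) => [p []//|].
  move=> p q [cp _ [n [n0 n1 n2 H]]] [cq _ _] [qp1 qp2].
  have aff : closed [set y | dot n (y - p) <= 0].
    by apply: closed_le_cts; exact: dotsub_cts.
  have : dot n (q - p) <= 0.
    by have := closureS H cq; rewrite -(closure_id _).1.
  rewrite leNgt => /negP; apply; rewrite /dot.
  have m1 : 0 <= n.1 * (q - p).1.
    by have := mulr_ge0 n1 (ltW qp1); rewrite mulrACA -expr2 a1 mul1r.
  have m2 : 0 <= n.2 * (q - p).2.
    by have := mulr_ge0 n2 (ltW qp2); rewrite mulrACA -expr2 b1 mul1r.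
  rewrite lt_neqAle addr_ge0 // andbT eq_sym paddr_eq0 //.
  have d1 : (q - p).1 != 0 by apply/eqP => E; move: qp1; rewrite E mulr0 ltxx.
  have d2 : (q - p).2 != 0 by apply/eqP => E; move: qp2; rewrite E mulr0 ltxx.
  rewrite !mulf_eq0 (negbTE d1) (negbTE d2) !orbF.
  by apply: contra n0 => /andP[/eqP e1 /eqP e2]; case: (n) e1 e2 => /= ? ? -> ->.
pose sg : seq (R * R) := [:: (1, 1); (1, -1); (-1, 1); (-1, -1)].
have H4 : length_bound [set p | exists2 i, i \in sg & Q i p] (\sum_(i <- sg) 4).
  apply: length_bound_bigcup => ab.
  by rewrite !inE => /or4P[] /eqP -> ; apply: QP; rewrite /= ?sqrrN expr1n.
apply: length_boundS _ _ H4; last by rewrite !big_cons big_nil; lra.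
move=> x [cx x1 [n n0 H]].
pose s1 : R := if 0 <= n.1 then 1 else -1.
pose s2 : R := if 0 <= n.2 then 1 else -1.
exists (s1, s2).
  by rewrite /s1 /s2 !inE; do 2 case: ifP => _; rewrite eqxx ?orbT.
split=> //; exists n; split=> //=.
- rewrite /s1; case: ifPn; rewrite ?mul1r // -ltNge mulN1r oppr_ge0; exact: ltW.
- rewrite /s2; case: ifPn; rewrite ?mul1r // -ltNge mulN1r oppr_ge0; exact: ltW.
Qed.

Lemma length_bound_circle : length_bound [set x : plane | enorm x = 1] 16.
Proof.
apply: length_boundS (lexx _) (@length_bound_supported (@B1 R)) => x /= x1.
split; [by apply: subset_closure; rewrite /B1 /= x1|by rewrite /B1 /= x1|].
exists x; first by apply/eqP => x0; move: x1; rewrite x0 enorm0 => /eqP;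
  rewrite eq_sym oner_eq0.
move=> y; rewrite /B1 /= => y1; rewrite dotBr subr_le0 -enorm_sqr x1 expr1n.
by apply: le_trans (dot_le _ _) _; rewrite x1 mul1r.
Qed.

(** The region [A] witnesses that the points off [S] on one side of [x] belong
    to components which have a supporting line at [x]. *)
Definition supported_side S x := exists A : set plane, [/\ boundary A `<=` S,
  closure A° x & supported A x].

(** The deterministic properties of a tessellation that bound its length by its
    number of cells. The exceptional set [D] is there for the vertices of a
    Delaunay tessellation. *)
Definition tame S := [/\ closed S, dense (~` S) &
  exists D : set plane, finite_set (D `&` @B1 R) /\
    forall x, S x -> ~ D x -> supported_side S x].

Lemma openB1 : open [set x : plane | enorm x < 1].
Proof. apply: open_lt_cts; exact: enorm_cts0. Qed.

(** An edge point of the open disk is adherent to the interior of the region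
    [A] of [supported_side]; finitely many cells share the nearby points of
    this interior, so it is adherent to one of them, and this cell stays in
    [A]. The circle accounts for the additional 16. *)
Lemma tame_length_bound S (I : set nat) (C : nat -> set plane) (s : seq nat) :
  tame S ->
  (forall i, I i -> is_cell S (C i)) ->
  (forall A, is_cell S A -> exists2 i, I i & C i = A) ->
  [set i | I i /\ C i `&` @B1 R !=set0] = [set` s] ->
  length_bound (S `&` @B1 R) (16 + 16 * (size s)%:R).
Proof.
move=> [cS dS [D [fD HD]]] cellC allC sE.
have H := length_bound_bigcup (fun i (_ : i \in s) => @length_bound_supported (C i)).
have := length_boundU (length_boundU length_bound_circle (length_bound_finite fD)) H.
apply: length_boundS; last first.
  by rewrite addr0 lerD2l big_const_seq count_predT iter_addr_0 mulr_natr.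
move=> x [Sx x1].
have [x1'|x1'] := eqVneq (enorm x) 1; first by do 2 left.
have xlt : enorm x < 1 by rewrite lt_neqAle x1'.
have [Dx|Dx] := pselect (D x); first by left; right.
right.
have [A [bA cA [n n0 nA]]] := HD _ Sx Dx.
(* Near [x], the points of the interior of [A] off [S] lie in cells of
   the list. *)
have cx : closure (\bigcup_(i in [set` s]) (C i `&` A°)) x.
  move=> B Bx.
  pose W := B° `&` [set x : plane | enorm x < 1] `&` A°.
  have Wo : open W.
    by apply: openI; [apply: openI;
      [exact: open_interior|exact: openB1]|exact: open_interior].
  have W0 : W !=set0.
    have : nbhs x (B° `&` [set x : plane | enorm x < 1]).
      by apply: filterI; [exact: nbhs_interior|apply: open_nbhs_nbhs;
        split=> //; exact: openB1].
    by move=> /cA[y [Ay By]]; exists y.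
  have [z [[[Bz z1] Az] Sz]] := dS _ W0 Wo.
  have [C0 cC0 C0z] := exists_cell cS Sz.
  have [i Ii CE] := allC _ cC0.
  exists z; split; last exact: interior_subset.
  exists i; last by rewrite CE.
  by rewrite -sE; split=> //; exists z; rewrite CE; split=> //; exact: ltW.
have [i /= si ci] := closure_fin (finite_seq s) cx.
exists i => //; split=> //.
  by apply: closureS ci => y [].
exists n => // y Ciy; apply: nA; move: y Ciy.
have [Ii _] : [set i | I i /\ C i `&` @B1 R !=set0] i by rewrite sE.
have [_ conC _ CS _] := cellC _ Ii.
apply: connected_side => //.
- by rewrite -subset0 => y [Cy /bA Sy]; rewrite -CS.
- by have [y [[Cy Ay] _]] := ci _ (@filterT _ _ _); exists y; split=> //;
  exact: interior_subset.
Qed.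

End Covers.

(** * One-dimensional Hausdorff measure and the hit-or-miss sigma-algebra *)

Section Hausdorff.
Variable R : realType.
Local Notation plane := (R * R)%type.
Implicit Types (x y z p q : plane) (A B S U : set plane).

Lemma ediam_le U (r : R) : 0 <= r ->
  (forall p q, U p -> U q -> enorm (p - q) <= r) -> (ediam U <= r%:E)%E.
Proof.
move=> r0 H; apply: ge_ereal_sup => _ [->|[[p q] /= [Up Uq] <-]].
  by rewrite lee_fin.
by rewrite lee_fin; exact: H.
Qed.

Lemma ediam_ge0 U : (0 <= ediam U)%E.
Proof. by apply: ereal_sup_ubound; left. Qed.

Lemma ediam_ge U p q : U p -> U q -> ((enorm (p - q))%:E <= ediam U)%E.
Proof. by move=> Up Uq; apply: ereal_sup_ubound; right; exists (p, q). Qed.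

Lemma length_bound_hausdorff1 A c : length_bound A c -> (hausdorff1 A <= c%:E)%E.
Proof.
move=> cA; apply: ge_ereal_sup => _ [delta /= d0 <-].
have [s [h1 h2 h3 h4]] := cA delta d0.
pose dflt : set plane * R := (set0, 0).
have n0 k : 0 <= (nth dflt s k).2 <= delta.
  have [ks|ks] := ltnP k (size s); first by apply: h2; exact: mem_nth.
  by rewrite nth_default //= lexx ltW.
have dk k : (ediam (nth dflt s k).1 <= (nth dflt s k).2%:E)%E.
  apply: ediam_le; first by case/andP: (n0 k).
  have [ks|ks] := ltnP k (size s); first by move=> p q; apply: h3; exact: mem_nth.
  by rewrite nth_default.
apply: ge_ereal_inf; exists (\sum_(0 <= k <oo) ediam (nth dflt s k).1)%E.
  exists (fun k => (nth dflt s k).1) => //; split.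
    move=> p /h1[u us up]; exists (index u s) => //=; by rewrite nth_index.
  by move=> k; apply: le_trans (dk k) _; rewrite lee_fin; case/andP: (n0 k).
apply: lime_le; first by apply: is_cvg_nneseries => k _ _; exact: ediam_ge0.
apply: nearW => N.
apply: (@le_trans _ _ (\sum_(0 <= k < N) (nth dflt s k).2%:E)%E).
  by apply: lee_sum => k _; exact: dk.
rewrite sumEFin lee_fin; apply: le_trans h4.
have s0 u : u \in s -> 0 <= u.2 by move=> /h2 /andP[].
elim: s N s0 {h1 h2 h3 n0 dk} => [|u s IH] [|N] s0.
- by rewrite !big_nil.
- by rewrite big_nil big1 // => k _; rewrite nth_nil.
- by rewrite big_geq // big_seq sumr_ge0.
- rewrite big_nat_recl //= big_cons lerD2l; apply: IH => v vs.
  by apply: s0; rewrite inE vs orbT.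
Qed.

Definition rat_square (b : rat * rat * rat) : set plane :=
  [set p | `|p.1 - ratr b.1.1| < ratr b.2 /\ `|p.2 - ratr b.1.2| < ratr b.2].

Lemma open_rat_square b : open (rat_square b).
Proof.
have nc (f : plane -> R) (c : R) : continuous f -> continuous (fun p => `|f p - c|).
  by move=> cf p; apply: cvg_norm; apply: cvgB; [exact: cf|exact: cvg_cst].
apply: openI.
- exact: (open_lt_cts (nc _ _ (@fst_cts R))).
- exact: (open_lt_cts (nc _ _ (@snd_cts R))).
Qed.

Lemma rat_square_diam b p q : rat_square b p -> rat_square b q ->
  enorm (p - q) <= 4 * ratr b.2.
Proof.
move=> [p1 p2] [q1 q2]; apply: le_trans (enorm_le_l1 _) _.
rewrite -[(p - q).1]/(p.1 - q.1) -[(p - q).2]/(p.2 - q.2).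
move: p1 p2 q1 q2; do 4 (case/ltr_normlP=> ? ?).
do 2 case: ler0P => _; lra.
Qed.

(** The radius exceeds the diameter by little, because the centre of the square
    is taken close to a point of [U]. *)
Lemma rat_square_cover U (d e : R) : 0 <= d -> 0 < e ->
  (forall p q, U p -> U q -> enorm (p - q) <= d) ->
  exists b, [/\ 0 < ratr b.2 :> R, ratr b.2 <= d + e & U `<=` rat_square b].
Proof.
move=> d0 e0 HU; have e2 : 0 < e / 2 by rewrite divr_gt0.
have [r] := @rat_in_itvoo R (d + e / 2) (d + e) ltac:(lra).
rewrite in_itv /= => /andP[r1 r2].
have [[u Uu]|U0] := pselect (U !=set0); last first.
  exists (0, 0, r); split=> //=; [lra|exact: ltW|move=> p Up; exfalso;
    apply: U0; by exists p].
have [a1] := @rat_in_itvoo R (u.1 - e / 2) (u.1 + e / 2) ltac:(lra).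
have [a2] := @rat_in_itvoo R (u.2 - e / 2) (u.2 + e / 2) ltac:(lra).
rewrite !in_itv /= => /andP[h1 h2] /andP[h3 h4].
exists (a1, a2, r); split=> /=; [lra|exact: ltW|move=> p Up].
have := le_trans (norm1_le_enorm _) (HU _ _ Up Uu).
have := le_trans (norm2_le_enorm _) (HU _ _ Up Uu).
rewrite -[(p - u).1]/(p.1 - u.1) -[(p - u).2]/(p.2 - u.2).
case/ler_normlP=> ? ? /ler_normlP[? ?]; split=> /=; apply/ltr_normlP; split; lra.
Qed.

Definition good_list (k n : nat) (l : seq (rat * rat * rat)) : bool :=
  all (fun b => 0 < (ratr b.2 : R) <= n.+1%:R^-1) l &&
    (\sum_(b <- l) (ratr b.2 : R) < k%:R).

(** A version of the statement that the length in the disk is less than [k],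
    which involves finite covers from a countable family only. *)
Definition short (k : nat) : set (set plane) :=
  [set S | forall n, exists2 l, good_list k n l &
     S `&` @B1 R `<=` [set p | exists2 b, b \in l & rat_square b p]].

Lemma compact_B1 : compact (@B1 R).
Proof.
apply: (@subclosed_compact _ _ (`[(-1 : R), 1]%classic `*` `[(-1 : R), 1]%classic)).
- exact: closed_B1.
- by apply: compact_setX; exact: segment_compact.
- move=> p p1; split; rewrite /= in_itv /= -ler_norml.
    exact: le_trans (norm1_le_enorm _) p1.
  exact: le_trans (norm2_le_enorm _) p1.
Qed.

(** The diameter of a square is at most 4 times its radius. *)
Lemma short_length_bound k S : short k S -> length_bound (S `&` @B1 R) (4 * k%:R).
Proof.
move=> Sk e e0; pose n := Num.truncn (4 / e).
have ne : 4 * n.+1%:R^-1 <= e.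
  by rewrite ler_pdivrMr ?ltr0n // mulrC -ler_pdivrMr // ltW // truncnS_gt.
have [l /andP[/allP l1 l2] Sl] := Sk n.
exists [seq (rat_square b, 4 * ratr b.2) | b <- l]; split.
- by move=> p /Sl[b bl bp]; exists (rat_square b, 4 * ratr b.2) => //; exact: map_f.
- move=> u /mapP[b /l1/andP[b0 b1] ->] /=; rewrite mulr_ge0 ?(ltW b0) //=.
  by apply: le_trans ne; rewrite ler_pM2l.
- by move=> u p q /mapP[b _ ->]; exact: rat_square_diam.
- by rewrite big_map -mulr_sumr ler_pM2l // ltW.
Qed.

(** For a fixed list of squares, the edges in the disk are covered if and only
    if the compact rest of the disk is missed. *)
Lemma hit_short k : hit_algebra (R := R) (short k).
Proof.
pose G := [set B | exists2 K : set plane, compact K & B = [set S | S `&` K !=set0]].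
pose T := g_sigma_algebraType G.
suff : measurable (short k : set T) by [].
pose M (l : seq (rat * rat * rat)) : set T :=
  [set S | S `&` @B1 R `<=` [set p | exists2 b, b \in l & rat_square b p]].
have -> : short k = \bigcap_n \bigcup_l (if good_list k n l then M l
  else set0) :> set T.
  apply/seteqP; split=> S HS n.
    by move=> _; have [l gl Sl] := HS n; exists l => //; rewrite gl.
  by have [l _] := HS n I; case: ifP => // gl Ml; exists l.
apply: bigcapT_measurable => n; apply: countable_bigcupT_measurable => [|l];
  first exact: countableP.
case: ifP => _; last exact: measurable0.
pose K := @B1 R `\` [set p | exists2 b, b \in l & rat_square b p].
have -> : M l = ~` [set S | S `&` K !=set0].
  apply/seteqP; split=> S.
    by move=> HS [p [Sp [p1 np]]]; apply: np; apply: HS.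
  move=> HS p [Sp p1]; apply: contrapT => np; apply: HS; by exists p.
apply: measurableC; apply: sub_sigma_algebra; exists K => //.
apply: (subclosed_compact _ compact_B1).
- apply: closedI; first exact: closed_B1.
  apply: open_closedC.
  have -> : [set p | exists2 b, b \in l & rat_square b p] =
    \bigcup_(b in [set` l]) rat_square b.
    by apply/seteqP; split=> p [b bl bp]; exists b.
  by apply: bigcup_open => b _; exact: open_rat_square.
- by move=> p [].
Qed.

(** Almost optimal countable covers are enlarged to rational squares, with a
    total error smaller than the slack in the hypothesis; compactness leaves
    finitely many squares. *)
Lemma hausdorff1_short k S : closed S -> (hausdorff1 (S `&` @B1 R) < k%:R%:E)%E ->
  short k S.
Proof.
move=> cS Hk n.
have n0 : (0 : R) < n.+1%:R^-1 by rewrite invr_gt0.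
pose delta : R := n.+1%:R^-1 / 2.
have d0 : 0 < delta by rewrite divr_gt0.
have : (hausdorff1_pre delta (S `&` @B1 R) < k%:R%:E)%E.
  by apply: le_lt_trans Hk; apply: ereal_sup_ubound; exists delta.
move=> /ereal_inf_lt[_ [U [SU dU] <-] Uk].
have Ufin i : ediam (U i) \is a fin_num.
  by rewrite ge0_fin_numE ?ediam_ge0 //; apply: le_lt_trans (dU i) (ltry _).
pose d i := fine (ediam (U i)).
have dE i : ediam (U i) = (d i)%:E by rewrite fineK.
have sfin : (\sum_(0 <= i <oo) ediam (U i) \is a fin_num)%E.
  rewrite ge0_fin_numE ?(lt_trans Uk) ?ltry //.
  by apply: nneseries_ge0 => i _ _; exact: ediam_ge0.
pose s := fine (\sum_(0 <= i <oo) ediam (U i))%E.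
have sk : s < k%:R by rewrite -lte_fin fineK.
(* The enlargements add up to less than [e]; the bound by [delta] keeps the
   radii below the mesh. *)
pose e := Num.min (k%:R - s) delta.
have e0 : 0 < e by rewrite lt_min subr_gt0 sk.
have ei i : 0 < e / 2 ^+ i.+1 by rewrite divr_gt0 // exprn_gt0.
have /boolp.choice[b Hb] : forall i, exists b : rat * rat * rat,
   [/\ 0 < ratr b.2 :> R, ratr b.2 <= d i + e / 2 ^+ i.+1 & U i `<=` rat_square b].
  move=> i; apply: rat_square_cover => //; first by rewrite -lee_fin -dE ediam_ge0.
  by move=> p q Up Uq; rewrite -lee_fin -dE; exact: ediam_ge.
have cpt : compact (S `&` @B1 R).
  apply: (subclosed_compact _ compact_B1); last by move=> p [].
  by apply: closedI => //; exact: closed_B1.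
have [N HN] : exists N, S `&` @B1 R `<=` [set p | exists2 i,
  (i < N)%N & rat_square (b i) p].
  have /compact_near_coveringP/(_ nat \oo (fun N p =>
    exists2 i, (i < N)%N & rat_square (b i) p) _) := cpt.
  move=> [|N _ HN]; last by exists N; apply: HN => /=.
  move=> p /SU[i _ Up].
  exists (rat_square (b i), [set M | (i < M)%N]);
    last by move=> [q M] [/= qb iM]; exists i.
  split=> /=; last by exists i.+1.
  by apply: open_nbhs_nbhs; split; [exact: open_rat_square|have [_ _] := Hb i; apply].
exists [seq b i | i <- iota 0 N]; last first.
  move=> p /HN[i iN bp]; exists (b i) => //.
  by apply: map_f; rewrite mem_iota /= add0n.
apply/andP; split.
  apply/allP => _ /mapP[i _ ->]; have [-> b2 _] := Hb i => /=.
  apply: (le_trans b2).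
  have h1 : d i <= delta by rewrite -lee_fin -dE.
  have h2 : e / 2 ^+ i.+1 <= delta.
    apply: (@le_trans _ _ e); last by rewrite /e ge_min lexx orbT.
    by rewrite ler_pdivrMr ?exprn_gt0 // ler_peMr ?(ltW e0) // exprn_ege1 // ler1n.
  by apply: le_trans (lerD h1 h2) _; rewrite /delta -splitr.
have esum M : \sum_(0 <= i < M) e / 2 ^+ i.+1 = e * (1 - (2 ^+ M)^-1).
  elim: M => [|M IH]; first by rewrite big_geq // expr0 invr1 subrr mulr0.
  rewrite big_nat_recr //= IH exprS; field; by rewrite expf_neq0.
have dsum : \sum_(0 <= i < N) d i <= s.
  rewrite -lee_fin fineK // -sumEFin.
  rewrite (_ : \sum_(0 <= i < N) (d i)%:E =
    \sum_(0 <= i < N) ediam (U i))%E; last first.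
    by apply: eq_bigr => i _; rewrite dE.
  by apply: nneseries_lim_ge => i _ _; exact: ediam_ge0.
rewrite big_map.
have -> : iota 0 N = index_iota 0 N by rewrite /index_iota subn0.
apply: (@le_lt_trans _ _ (\sum_(0 <= i < N) (d i + e / 2 ^+ i.+1))).
  by apply: ler_sum => i _; have [] := Hb i.
rewrite big_split /= esum.
have : e * (1 - (2 ^+ N)^-1) < e.
  by rewrite gtr_pMr // gtrBl invr_gt0 exprn_gt0.
have : e <= k%:R - s by rewrite /e ge_min lexx.
lra.
Qed.

End Hausdorff.

(** * Line, Johnson--Mehl and Voronoi tessellations *)

Section Tame.
Variable R : realType.
Local Notation plane := (R * R)%type.
Implicit Types (y z p q : plane) (A B S U : set plane).

Lemma argmin_finite (K : eqType) (A : set K) (g : K -> R) k : finite_set A -> A k ->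
  exists2 i, A i & forall j, A j -> g i <= g j.
Proof.
move=> /finite_seqP[s ->]; elim: s k => [//|a s IH] k.
case: s IH => [|b s] IH.
  by move=> _; exists a => /=; rewrite ?mem_head // => j; rewrite inE => /eqP ->.
move=> _; have [i /= si Hi] := IH b (mem_head _ _).
have [ai|ia] := leP (g a) (g i).
  exists a => /=; first by rewrite mem_head.
  by move=> j; rewrite inE => /orP[/eqP ->//|/Hi]; exact: le_trans.
exists i => /=; first by rewrite inE si orbT.
by move=> j; rewrite inE => /orP[/eqP ->|/Hi//]; exact: ltW.
Qed.

(** The closed half-plane below a line is a region as required, whatever the
    other lines. *)
Lemma tame_lines (K : choiceType) (I : set K) (a : K -> plane) (b : K -> R) :
  (forall i, I i -> enorm (a i) = 1) ->
  (forall r, finite_set [set i | I i /\ `|b i| <= r]) ->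
  tame (\bigcup_(i in I) [set y | dot (a i) y = b i]).
Proof.
move=> a1 lf; have a0 i : I i -> a i != 0.
  by move=> /a1 H; apply/eqP => E; move: H; rewrite E enorm0 => /eqP;
    rewrite eq_sym oner_eq0.
have lf' r : finite_set [set i | I i /\
  exists2 y, [set y | dot (a i) y = b i] y & enorm y <= r].
  apply: sub_finite_set (lf r) => i [Ii [y /= <- yr]]; split=> //.
  have h1 := dot_le (a i) y; have := dot_le (- a i) y; rewrite enormN.
  have -> : dot (- a i) y = - dot (a i) y by rewrite dotC dotNr dotC.
  rewrite a1 // mul1r in h1; rewrite a1 // mul1r => h2; rewrite ler_norml; lra.
have cl i : I i -> closed [set y | dot (a i) y = b i] by move=> _; exact: closed_line.
split; first exact: locfin_closed cl lf'.
  by apply: locfin_dense => // i Ii; apply: line_interior0; exact: a0.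
exists set0; split; first by rewrite set0I.
move=> y [i Ii yi] _.
have n0 := dot_gt0 (a0 _ Ii).
exists [set z | dot (a i) z <= b i]; split.
- move=> z [cz iz]; exists i => //=.
  have : z \in [set z | dot (a i) z <= b i].
    by rewrite inE [X in X z](closure_id _).1 //; apply: closed_le_cts; exact: dot_cts.
  rewrite inE /= le_eqVlt => /orP[/eqP//|lt]; exfalso; apply: iz.
  have oH : open [set z | dot (a i) z < b i] by apply: open_lt_cts; exact: dot_cts.
  have : [set z | dot (a i) z < b i] `<=` [set z | dot (a i) z <= b i] by move=> ? /ltW.
  by rewrite (open_subsetE _ oH); exact.
- apply: (@closure_ray _ y (- a i) _ 1) => // s /andP[s0 _].
  have oH : open [set z | dot (a i) z < b i] by apply: open_lt_cts; exact: dot_cts.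
  have : [set z | dot (a i) z < b i] `<=` [set z | dot (a i) z <= b i] by move=> ? /ltW.
  rewrite (open_subsetE _ oH); apply => /=.
  by rewrite scalerN dotBr dotZr yi ltrBlDr ltrDl mulr_gt0.
- exists (a i); first exact: a0.
  by move=> z /=; rewrite dotBr yi subr_le0.
Qed.

Section JM.
Variables (I : set nat) (x : nat -> plane) (t : nat -> R).
Hypothesis t0 : forall i, 0 <= t i.
Hypothesis lf : forall r, finite_set [set n | I n /\ enorm (x n) <= r].

(** The time at which the growth of the nucleus [i] reaches [y]. *)
Definition wdist i y := enorm (y - x i) + t i.

(** The region of the nucleus [i] in the Johnson--Mehl tessellation. *)
Definition jcell i := [set y | forall j, I j -> wdist i y <= wdist j y].

Lemma wdistE i y : dJ (y, 0) (x i, t i) = wdist i y.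
Proof. by rewrite /dJ /wdist /= subr0 ger0_norm. Qed.

Lemma wdist_ge0 i y : 0 <= wdist i y.
Proof. by rewrite addr_ge0 // enorm_ge0. Qed.

Lemma jcellE i : I i ->
  [set y | dJ (y, 0) (x i, t i) = inf [set dJ (y, 0) (x j, t j) | j in I]] = jcell i.
Proof.
move=> Ii; apply/seteqP; split=> y /=.
  rewrite wdistE => E j Ij; rewrite E; apply: ge_inf;
    last by exists j => //; rewrite wdistE.
  by exists 0 => _ [k _ <-]; rewrite wdistE wdist_ge0.
move=> H; apply/eqP; rewrite eq_le; apply/andP; split.
  apply: lb_le_inf; first by exists (wdist i y), i => //; rewrite wdistE.
  by move=> _ [k Ik <-]; rewrite !wdistE; exact: H.
apply: ge_inf; last by exists i.
by exists 0 => _ [k _ <-]; rewrite wdistE wdist_ge0.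
Qed.

Lemma johnson_mehlE : johnson_mehl I x t = \bigcup_(i in I) boundary (jcell i).
Proof. by apply: eq_bigcupr => i Ii; rewrite jcellE. Qed.

Lemma wdist_cts i : continuous (wdist i).
Proof. by move=> y; apply: cvgD; [exact: enorm_cts|exact: cvg_cst]. Qed.

Lemma closed_jcell i : closed (jcell i).
Proof.
have -> : jcell i = \bigcap_(j in I) [set y | wdist i y - wdist j y <= 0].
  by apply/seteqP; split=> y H j Ij; move: (H _ Ij); rewrite /= subr_le0.
apply: closed_bigI => j _; apply: closed_le_cts => y.
by apply: cvgB; exact: wdist_cts.
Qed.

Lemma jcell_ex k y : I k -> exists2 i, I i & jcell i y.
Proof.
move=> Ik; pose A := [set n | I n /\ enorm (x n) <= enorm y + wdist k y].
have small n : I n -> wdist n y <= wdist k y -> A n.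
  move=> In nk; split=> //.
  have := enorm_tri (x n) y 0; rewrite !subr0 enormC addrC => h.
  apply: le_trans h _; rewrite lerD2l; apply: le_trans nk.
  by rewrite /wdist lerDl.
have [i [Ii _] Hi] := argmin_finite (fun n => wdist n y) (lf _) (small _ Ik (lexx _)).
exists i => // j Ij; have [jk|/ltW kj] := leP (wdist j y) (wdist k y).
  by apply: Hi; exact: small.
by apply: le_trans kj; apply: Hi; exact: small.
Qed.

Lemma jcell_locfin r : finite_set [set i | I i /\ exists2 y, jcell i y & enorm y <= r].
Proof.
have [[k Ik]|I0] := pselect (I !=set0); last first.
  by rewrite (_ : [set _ | _] = set0) // -subset0 => i [Ii _]; apply: I0; exists i.
apply: sub_finite_set (lf (r + (r + enorm (x k) + t k))) =>
  i [Ii [y Hy yr]]; split=> //.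
have h1 : enorm (x i) <= enorm y + enorm (y - x i).
  by have := enorm_tri (x i) y 0; rewrite !subr0 enormC addrC.
have h2 := Hy _ Ik; rewrite /wdist in h2.
have h3 : enorm (y - x k) <= enorm y + enorm (x k).
  by rewrite -[enorm (x k)]enormN; exact: enormD.
have := t0 i; lra.
Qed.

Lemma jm_closed : closed (johnson_mehl I x t).
Proof.
rewrite johnson_mehlE; apply: locfin_closed => [i _|r]; first exact: closed_boundary.
apply: sub_finite_set (jcell_locfin r) => i [Ii [y [cy _] yr]]; split=> //.
by exists y => //; rewrite [X in X y](closure_id _).1 //; exact: closed_jcell.
Qed.

Lemma jm_dense : dense (~` johnson_mehl I x t).
Proof.
rewrite johnson_mehlE; apply: locfin_dense => [i _|r|i _].
- exact: closed_boundary.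
- apply: sub_finite_set (jcell_locfin r) => i [Ii [y [cy _] yr]]; split=> //.
  by exists y => //; rewrite [X in X y](closure_id _).1 //; exact: closed_jcell.
- by apply: boundary_interior0; exact: closed_jcell.
Qed.

(** Near a boundary point of a region there are points of finitely many other
    regions, which are closed. *)
Lemma jm_boundary i y : I i -> boundary (jcell i) y ->
  exists j, [/\ I j, jcell j y & (x j, t j) != (x i, t i)].
Proof.
move=> Ii [_ iy].
pose D := [set j | I j /\ exists2 z, (jcell j `\` jcell i) z & enorm z <= enorm y + 1].
have fD : finite_set D.
  apply: sub_finite_set (jcell_locfin (enorm y + 1)) =>
    j [Ij [z [Hz _] zr]]; split=> //.
  by exists z.
have : closure (\bigcup_(j in D) (jcell j `\` jcell i)) y.
  move=> B By.
  have : nbhs y (B `&` [set z | enorm (z - y) < 1]) by apply: filterI => //;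
    exact: enorm_nbhs.
  have : closure (~` jcell i) y by rewrite closure_setC.
  move=> cy /cy[z [nz [Bz zy]]].
  have [j Ij jz] := jcell_ex z Ii.
  exists z; split=> //; exists j => //; split=> //; exists z => //.
  have := enorm_tri z y 0; rewrite !subr0 /= in zy *; lra.
case/(closure_fin fD) => j [Ij [z [jz niz] _]] cj.
exists j; split=> //.
  rewrite [X in X y](closure_id _).1; last exact: closed_jcell.
  by apply: closureS cj => u [].
apply: contra_notN niz => /eqP[xE tE] k Ik.
by have := jz _ Ik; rewrite /wdist xE tE.
Qed.

(** No nucleus is born at the moment when it is reached by another one.
    Otherwise its region may be a half-line, which belongs to the tessellation
    without bounding a cell. *)
Definition nondegenerate := forall i j, I i -> I j ->
  (x j, t j) != (x i, t i) -> enorm (x i - x j) != `|t i - t j|.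

Hypothesis nd : nondegenerate.

(** The region is star-shaped with respect to its nucleus. Equality in the
    triangle inequality along a ray to the nucleus would put a second nucleus
    on that ray, at a degenerate distance. *)
Lemma jcell_ray i y s : I i -> jcell i y -> 0 < s <= 1 ->
  (jcell i)° (y + s *: (x i - y)).
Proof.
move=> Ii iy /andP[s0 s1]; set p := y + _.
have pi : enorm (p - x i) = (1 - s) * enorm (x i - y).
  have -> : p - x i = (1 - s) *: (y - x i).
    by rewrite /p; congr pair => /=; rewrite /GRing.scale /=; ring.
  by rewrite enormZ ger0_norm ?subr_ge0 // enormC.
have strict j : I j -> (x j, t j) != (x i, t i) -> wdist i p < wdist j p.
  move=> Ij ne; have := iy _ Ij; rewrite /wdist => ij.
  have h1 : enorm (y - x j) <= enorm (p - x j) + s * enorm (x i - y).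
    apply: le_trans (enorm_tri _ p _) _; rewrite addrC lerD2l.
    by rewrite /p opprD addrA subrr sub0r enormN enormZ gtr0_norm.
  rewrite lt_neqAle; apply/andP; split; last first.
    rewrite pi; have := enormC y (x i); lra.
  apply/negP => /eqP E.
  have h2 : enorm (p - x j) = enorm (y - x j) - s * enorm (x i - y).
    apply/eqP; rewrite eq_le; apply/andP; split; last by lra.
    rewrite pi in E; have := enormC y (x i); lra.
  have [a aE] : exists a, a = x i - y by exists (x i - y).
  have [b bE] : exists b, b = x j - y by exists (x j - y).
  have h3 : enorm (b - s *: a) = enorm b - s * enorm a.
    have -> : b - s *: a = - (p - x j).
      by rewrite bE aE /p; congr pair => /=; rewrite /GRing.scale /=; ring.
    by rewrite enormN h2 aE bE (enormC y).
  (* Equality in the Cauchy--Schwarz inequality: both nuclei lie on the same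
     ray from [y]. *)
  have h4 : dot a b = enorm a * enorm b.
    have := congr1 (fun r => r ^+ 2) h3; rewrite enorm_sqr /=.
    have -> : dot (b - s *: a) (b - s *: a) =
      dot b b - 2 * s * dot a b + s ^+ 2 * dot a a.
      by rewrite !(dotBr, dotBl, dotZr, dotZl) (dotC b a); ring.
    rewrite -!enorm_sqr => e; apply: (mulfI (lt0r_neq0 s0)).
    move: e; rewrite !expr2; lra.
  have h5 : enorm (a - b) = `|enorm a - enorm b|.
    apply/eqP; rewrite -(@eqrXn2 _ 2) ?enorm_ge0 // enorm_sqr real_normK ?num_real //.
    rewrite !(dotBr, dotBl) (dotC b a) h4 -!enorm_sqr; apply/eqP; ring.
  have := nd Ii Ij ne; apply/negP; rewrite negbK.
  have -> : x i - x j = a - b by rewrite aE bE opprB addrA subrK.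
  rewrite h5.
  have -> : enorm a - enorm b = t j - t i.
    rewrite pi h2 in E; rewrite aE bE (enormC (x j)); lra.
  by rewrite distrC.
have ip : jcell i p.
  move=> j Ij; have [[xE tE]|ne] := eqVneq (x j, t j) (x i, t i).
    by rewrite /wdist xE tE.
  by apply: ltW; exact: strict.
apply: contrapT => np.
have [|j [Ij jp ne]] := @jm_boundary i p Ii; first by split=> //; exact: subset_closure.
by have := lt_le_trans (strict _ Ij ne) (jp _ Ii); rewrite ltxx.
Qed.

(** For the later nucleus [i] the branch of hyperbola [|y - x j| - |y - x i| =
    c] is convex around [x i]: squaring [|z - x j| >= |z - x i| + c] and
    bounding [|z - x i|] from below by its linear part at [y] gives a linear
    inequality on the region. *)
Lemma jcell_supported i j y : I i -> I j -> jcell i y -> jcell j y ->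
  (x j, t j) != (x i, t i) -> t j <= t i -> supported (jcell i) y.
Proof.
move=> Ii Ij iy jy ne tji; set c := t i - t j.
have c0 : 0 <= c by rewrite subr_ge0.
have yij : enorm (y - x j) = enorm (y - x i) + c.
  by have := iy _ Ij; have := jy _ Ii; rewrite /wdist /c; lra.
(* a unit vector along y - x i, or any unit vector when y = x i *)
have [u u1 yu] : exists2 u : plane, enorm u = 1 & y - x i = enorm (y - x i) *: u.
  have [E|n0] := eqVneq (y - x i) 0.
    exists (1, 0); last by rewrite E enorm0 scale0r.
    by rewrite /enorm /= expr1n expr0n /= addr0 sqrtr1.
  have e0 : enorm (y - x i) != 0 by apply: contra_neq n0 => /enorm_eq0.
  exists ((enorm (y - x i))^-1 *: (y - x i)); last by rewrite scalerA divff // scale1r.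
  by rewrite enormZ ger0_norm ?invr_ge0 ?enorm_ge0 // mulVf.
pose n := c *: u - (x i - x j).
exists n.
  apply/eqP => /eqP; rewrite /n subr_eq0 => /eqP E.
  by move: (nd Ii Ij ne); rewrite -E enormZ u1 mulr1 -/c eqxx.
move=> z iz.
have h1 : enorm (z - x i) + c <= enorm (z - x j).
  by have := iz _ Ij; rewrite /wdist /c; lra.
have h2 : dot (z - x i) u <= enorm (z - x i).
  by apply: le_trans (dot_le _ _) _; rewrite u1 mulr1.
have h3 : (enorm (z - x i) + c) ^+ 2 <= dot (z - x j) (z - x j).
  by rewrite -enorm_sqr; apply: lerXn2r => //; rewrite nnegrE;
    [apply: addr_ge0 => //|]; exact: enorm_ge0.
have h4 : dot (y - x j) (y - x j) =
  (enorm (y - x i) + c) ^+ 2 by rewrite -enorm_sqr yij.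
have h5 : dot (y - x i) u = enorm (y - x i).
  by rewrite {1}yu dotZl -enorm_sqr u1 expr1n mulr1.
rewrite sqrrD enorm_sqr in h3; rewrite sqrrD enorm_sqr in h4.
have h6 : c * dot (z - x i) u <= c * enorm (z - x i) by rewrite ler_wpM2l.
have -> : dot n (z - y) = c * dot (z - x i) u - c * dot (y - x i) u
   - (dot (z - x j) (z - x j) - dot (z - x i) (z - x i)) / 2
   + (dot (y - x j) (y - x j) - dot (y - x i) (y - x i)) / 2.
  by rewrite /n !(dotBr, dotBl, dotZr,
    dotZl) (dotC (x i) z) (dotC (x j) z) (dotC (x i) y)
     (dotC (x j) y) !(dotC u); field.
rewrite h4 h5; lra.
Qed.

Lemma tame_johnson_mehl : tame (johnson_mehl I x t).
Proof.
split; [exact: jm_closed|exact: jm_dense|exists set0; split; first by rewrite set0I].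
move=> y; rewrite {1}johnson_mehlE => -[i Ii iy] _.
have yi : jcell i y by case: iy => + _; rewrite -(closure_id _).1 //;
  exact: closed_jcell.
have [j [Ij jy ne]] := jm_boundary Ii iy.
wlog tji : i j Ii Ij yi jy ne {iy} / t j <= t i.
  move=> H; have [ij|ji] := leP (t j) (t i); first exact: (H i j).
  by apply: (H j i) => //; [rewrite eq_sym|exact: ltW].
exists (jcell i); split.
- by rewrite johnson_mehlE => z bz; exists i.
- by apply: (@closure_ray _ y (x i - y) _ 1) => // s /andP[s0 /ltW s1];
  apply: jcell_ray; rewrite ?s0.
- exact: (jcell_supported Ii Ij).
Qed.

End JM.
End Tame.

(** * Delaunay tessellations *)

Section Delaunay.
Variable R : realType.
Local Notation plane := (R * R)%type.
Implicit Types (u v y z p q : plane) (A B S U : set plane).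

(** Rotation by a right angle, so that [dot (perp u) v] is the determinant of
    [u] and [v]. *)
Definition perp u : plane := (- u.2, u.1).

Lemma perp_neq0 u : u != 0 -> perp u != 0.
Proof.
by apply: contra; case: u => a b /eqP[/eqP]; rewrite oppr_eq0 => /eqP -> ->.
Qed.

(** The region is the closed triangle, described by its barycentric coordinates
    up to the factor [D]. *)
Lemma triangle_supported_side S p q v z :
  segment p q `<=` S -> segment q v `<=` S -> segment v p `<=` S ->
  0 < dot (perp (q - p)) (v - p) ->
  (exists2 s : R, 0 < s < 1 & z = s *: p + (1 - s) *: q) -> supported_side S z.
Proof.
move=> Spq Sqv Svp; set D := dot _ _ => D0 [s /andP[s0 s1] zE].
pose l1 u := dot (perp (v - q)) (u - q).
pose l2 u := dot (perp (p - v)) (u - v).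
pose l3 u := dot (perp (q - p)) (u - p).
have lsum u : l1 u + l2 u + l3 u = D.
  by rewrite /l1 /l2 /l3 /D /perp /dot !coordE /=; ring.
have bary u : D *: u = l1 u *: p + l2 u *: q + l3 u *: v.
  by apply: plane_eq; rewrite /l1 /l2 /l3 /D /perp /dot !coordE /=; ring.
have c1 : continuous l1 by exact: dotsub_cts.
have c2 : continuous l2 by exact: dotsub_cts.
have c3 : continuous l3 by exact: dotsub_cts.
pose A := [set u | 0 <= l1 u] `&` [set u | 0 <= l2 u] `&` [set u | 0 <= l3 u].
pose A' := [set u | 0 < l1 u] `&` [set u | 0 < l2 u] `&` [set u | 0 < l3 u].
have cA : closed A by repeat apply: closedI; exact: closed_ge_cts.
have oA' : open A' by repeat apply: openI; exact: open_gt_cts.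
have A'A : A' `<=` A by move=> u [[/ltW ? /ltW ?] /ltW ?].
have A'i : A' `<=` A° by rewrite -open_subsetE.
have seg a b c la lb lc u : la + lb + lc = D -> D *: u = la *: a + lb *: b + lc *: c ->
    0 <= la -> 0 <= lb -> lc = 0 -> segment a b u.
  move=> E1 E2 a0 b0 c0; rewrite c0 ?scale0r !addr0 in E1 E2.
  have Dn : D != 0 by rewrite gt_eqF.
  exists (la / D).
    by rewrite divr_ge0 ?(ltW D0) //= ler_pdivrMr // mul1r -E1 lerDl.
  have -> : 1 - la / D = lb / D.
    by rewrite -[1](divff Dn) -mulrBl -E1 addrAC subrr add0r.
  by rewrite ![_ / D]mulrC -!scalerA -scalerDr -E2 scalerA mulVf // scale1r.
exists A; split.
- move=> u [cu iu].
  have [[/= u1 u2] u3] : A u by rewrite [X in X u](closure_id _).1.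
  have [e1|n1] := eqVneq (l1 u) 0.
    apply: Sqv; apply: (seg q v p (l2 u) (l3 u) (l1 u)) => //.
      by rewrite -(lsum u); ring.
    by rewrite bary; apply: plane_eq; rewrite !coordE; ring.
  have [e2|n2] := eqVneq (l2 u) 0.
    apply: Svp; apply: (seg v p q (l3 u) (l1 u) (l2 u)) => //.
      by rewrite -(lsum u); ring.
    by rewrite bary; apply: plane_eq; rewrite !coordE; ring.
  have [e3|n3] := eqVneq (l3 u) 0.
    by apply: Spq; apply: (seg p q v (l1 u) (l2 u) (l3 u)).
  exfalso; apply: iu; apply: A'i; rewrite /A' /=.
  by rewrite !lt_neqAle u1 u2 u3 !(eq_sym 0) n1 n2 n3.
- apply: (@closure_ray _ z (v - z) _ 1) => // e /andP[e0 e1].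
  apply: A'i; rewrite /A' /=.
  have -> : l1 (z + e *: (v - z)) = (1 - e) * s * D.
    by rewrite zE /l1 /D /perp /dot !coordE /=; ring.
  have -> : l2 (z + e *: (v - z)) = (1 - e) * (1 - s) * D.
    by rewrite zE /l2 /D /perp /dot !coordE /=; ring.
  have -> : l3 (z + e *: (v - z)) = e * D.
    by rewrite zE /l3 /D /perp /dot !coordE /=; ring.
  by split; [split|]; rewrite /= ?mulr_gt0 ?subr_gt0.
- exists (- perp (q - p)).
    rewrite oppr_eq0; apply: perp_neq0; apply: contraTneq D0 => E.
    by rewrite /D E /perp /dot /= oppr0 !mul0r addr0 ltxx.
  move=> u [_ /= u3].
  have : l3 z = 0 by rewrite zE /l3 /perp /dot !coordE /=; ring.
  have : dot (- perp (q - p)) (u - z) = l3 z - l3 u.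
    by rewrite /l3 /perp /dot !coordE /=; ring.
  by move=> -> ->; rewrite sub0r oppr_le0.
Qed.

Section Configuration.
Variables (I : set nat) (x : nat -> plane).
Hypothesis lf : forall r, finite_set [set n | I n /\ enorm (x n) <= r].

Let jc := jcell I x (fun=> 0).

Lemma dJ_unmarked p y : dJ (y, 0) (p, 0) = enorm (y - p).
Proof. by rewrite /dJ /= subr0 normr0 addr0. Qed.

Lemma inf_dJ_unmarked y :
  inf [set dJ (y, 0) (x j, 0) | j in I] = inf_dist I x y.
Proof. by congr inf; apply: eq_imagel => j _; rewrite dJ_unmarked. Qed.

Lemma voronoiE : voronoi I x = johnson_mehl I x (fun=> 0).
Proof.
apply: eq_bigcupr => i Ii; congr boundary; apply/seteqP.
by split=> y /=; rewrite dJ_unmarked inf_dJ_unmarked.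
Qed.

Lemma inf_distE i y : I i -> (enorm (y - x i) = inf_dist I x y) <-> jc i y.
Proof.
move=> Ii; rewrite /jc -(jcellE x (t := fun=> 0)) //=.
by rewrite dJ_unmarked inf_dJ_unmarked.
Qed.

Lemma jc_equidistant i j y : I i -> I j -> jc i y -> jc j y ->
  enorm (y - x i) = enorm (y - x j).
Proof.
move=> Ii Ij iy jy; apply/eqP; rewrite eq_le.
by have := iy _ Ij; have := jy _ Ii; rewrite /wdist !addr0 => -> ->.
Qed.

(** A point which is nearest to two distinct generators is a boundary point:
    moving towards one of them leaves the region of the other. *)
Lemma voronoi_in i j y : I i -> I j -> x i <> x j -> jc i y -> jc j y -> voronoi I x y.
Proof.
move=> Ii Ij ne iy jy; rewrite voronoiE johnson_mehlE //; exists i => //.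
split; first exact: subset_closure.
suff : closure (~` jc i) y by rewrite closure_setC.
apply: (@closure_ray _ y (x j - x i) _ 1) => // s /andP[s0 _] H.
have := H _ Ij; rewrite /wdist !addr0 le_enorm.
have e := jc_equidistant Ii Ij iy jy.
have e2 : dot (y - x i) (y - x i) = dot (y - x j) (y - x j) by rewrite -!enorm_sqr e.
have d0 : 0 < dot (x j - x i) (x j - x i).
  by apply: dot_gt0; rewrite subr_eq0; apply/eqP => E; apply: ne.
have := mulr_gt0 s0 d0; move: e2; rewrite /dot !coordE; nra.
Qed.

Definition edge (ij : nat * nat) := [/\ I ij.1, I ij.2 &
  exists y, [/\ voronoi I x y, jc ij.1 y & jc ij.2 y]].

Lemma delaunayE : delaunay I x = \bigcup_(ij in edge) segment (x ij.1) (x ij.2).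
Proof.
apply/seteqP; split=> z.
  move=> [i [j [s [Ii Ij s01 -> [y Vy [ij jy]]]]]]; exists (i, j); last by exists s.
  split=> //; exists y; split=> //; apply/inf_distE => //; by rewrite ij.
move=> [[i j] [/= Ii Ij [y [Vy iy jy]]] [s s01 ->]]; exists i, j, s; split=> //.
exists y => //.
by split; [rewrite ((inf_distE _ Ii).2 iy) ((inf_distE _ Ij).2 jy)|apply/inf_distE].
Qed.

(** A convenient form of the condition that the configuration extends in all
    directions; stationarity provides it. *)
Definition spread := forall (a : nat) (b1 b2 : bool), exists n, [/\ I n,
  a%:R <= (-1) ^+ b1 * (x n).1 & a%:R <= (-1) ^+ b2 * (x n).2].

Hypothesis sp : spread.

Lemma spread_dot u (c : R) : u != 0 -> exists2 n, I n & c < dot u (x n).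
Proof.
move=> u0; set l := `|u.1| + `|u.2|.
have l0 : 0 < l.
  rewrite lt_neqAle addr_ge0 // andbT eq_sym paddr_eq0 // !normr_eq0.
  by apply: contra u0 => /andP[/eqP a /eqP b]; apply/eqP/plane_eq.
pose a := (Num.truncn (`|c| / l)).+1.
have ac : c < a%:R * l.
  by apply: le_lt_trans (ler_norm _) _; rewrite -ltr_pdivrMr // truncnS_gt.
have [n [In n1 n2]] := sp a (u.1 < 0) (u.2 < 0).
exists n => //; apply: (lt_le_trans ac); rewrite /dot /l mulrDr.
have sgn (r q : R) : a%:R <= (-1) ^+ (r < 0)%R * q -> a%:R * `|r| <= r * q.
  by case: (ltrP r 0) => r0; [rewrite ltr0_norm // expr1|rewrite ger0_norm //
    expr0] => h; nra.
by apply: lerD; exact: sgn.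
Qed.

(** An empty disk that meets the disk of radius [r] cannot be large: in the
    quadrant of its centre there is a point of the configuration far from the
    origin, and a large empty disk would contain it. *)
Lemma edge_locfin r : finite_set
  [set ij | edge ij /\ exists2 z, segment (x ij.1) (x ij.2) z & enorm z <= r].
Proof.
pose a := (Num.truncn (`|r| + 1)).+1.
have ar : `|r| + 1 <= a%:R by rewrite ltW // truncnS_gt.
have /boolp.choice[k Hk] : forall b : bool * bool, exists n, [/\ I n,
    a%:R <= (-1) ^+ b.1 * (x n).1 & a%:R <= (-1) ^+ b.2 * (x n).2].
  by case=> b1 b2; exact: sp.
pose m b := dot (x (k b)) (x (k b)).
pose M := m (true, true) + m (true, false) + m (false, true) + m (false, false).
have mM b : m b <= M.
  have m0 b' : 0 <= m b' by exact: dot_ge0.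
  have := (m0 (true, true), m0 (true, false), m0 (false, true), m0 (false, false)).
  by case: b => -[] [] [[[? ?] ?] ?]; rewrite /M; lra.
apply: sub_finite_set (finite_setX (lf (2 * M + 1)) (lf (2 * M + 1))).
move=> [i j] /= [[/= Ii Ij [y [_ iy jy]]] [z [s /andP[s0 s1] zE] zr]].
(* The point [p] lies in the quadrant of the centre [y]; the disk contains [z]
   and has no generator inside, so [p] is not closer to [y] than [z]. *)
pose b := (y.1 < 0, y.2 < 0); set p := x (k b).
have [Ip p1 p2] := Hk b.
have eij := jc_equidistant Ii Ij iy jy.
have yp : enorm (y - x i) <= enorm (y - p).
  by have := iy _ Ip; rewrite /wdist !addr0.
have yz : enorm (y - z) <= enorm (y - x i).
  have -> : y - z = s *: (y - x i) + (1 - s) *: (y - x j).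
    by rewrite zE; apply: plane_eq; rewrite !coordE; ring.
  apply: le_trans (enormD _ _) _; rewrite !enormZ !ger0_norm ?subr_ge0 // -eij.
  by rewrite -mulrDl addrC subrK mul1r.
have h1 : dot (y - z) (y - z) <= dot (y - p) (y - p) by rewrite -le_enorm (le_trans yz).
have h2 : dot y z <= enorm y * `|r|.
  apply: le_trans (dot_le _ _) _; rewrite ler_wpM2l ?enorm_ge0 //.
  exact: le_trans (ler_norm _).
have h3 : (`|r| + 1) * enorm y <= dot y p.
  have sgn (c q : R) : a%:R <= (-1) ^+ (c < 0)%R * q -> (`|r| + 1) * `|c| <= c * q.
    move=> H; have {H} : a%:R * `|c| <= c * q.
      by move: H; case: (ltrP c 0) => c0;
        [rewrite ltr0_norm // expr1|rewrite ger0_norm // expr0] => h; nra.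
    by apply: le_trans; rewrite ler_wpM2r.
  apply: (@le_trans _ _ ((`|r| + 1) * (`|y.1| + `|y.2|))).
    by rewrite ler_wpM2l ?addr_ge0 // enorm_le_l1.
  by rewrite mulrDr; apply: lerD; apply: sgn.
have h4 : 2 * dot y p <= dot p p + 2 * dot y z.
  have := dot_ge0 z; move: h1; rewrite !(dotBl, dotBr) (dotC z y) (dotC p y); lra.
have pM : dot p p <= M := mM b.
have ym : 2 * enorm y <= M.
  by rewrite mulrDl mul1r in h3; rewrite mulrC in h2; lra.
have pm : enorm p <= M + 1.
  by move: pM; rewrite -enorm_sqr expr2; have := enorm_ge0 p; nra.
have xi n : enorm (y - x n) <= enorm (y - p) -> enorm (x n) <= 2 * M + 1.
  move=> yn; have := enorm_tri (x n) y 0; rewrite !subr0 enormC.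
  have := enormD y (- p); rewrite enormN; lra.
by split; split=> //; apply: xi => //; rewrite -eij.
Qed.

(** The disks through [x i] and [x j] have their centres [y + s nu] on a line.
    As [s] grows from 0, the disk loses points on one side of the edge and
    gains points on the other side; the first point [x k] which it reaches
    there gives an empty disk with three generators on its boundary. *)
Lemma pencil i j y : I i -> I j -> x i <> x j -> jc i y -> jc j y ->
  exists k y', [/\ I k, 0 < dot (perp (x j - x i)) (x k - x i) &
     [/\ jc i y', jc j y' & jc k y']].
Proof.
move=> Ii Ij ne iy jy; set nu := perp (x j - x i).
have nu0 : nu != 0 by apply: perp_neq0; rewrite subr_eq0; apply/eqP => E; apply: ne.
pose h k := dot nu (x k - x i).
pose g k := dot (y - x k) (y - x k) - dot (y - x i) (y - x i).
have g0 k : I k -> 0 <= g k.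
  by move=> Ik; rewrite subr_ge0 -le_enorm; have := iy _ Ik; rewrite /wdist !addr0.
pose yt (s : R) := y + s *: nu.
(* The difference of the powers of two generators is affine in [s]. *)
have power s k : dot (yt s - x k) (yt s - x k) - dot (yt s - x i) (yt s - x i)
    = g k - 2 * s * h k.
  by rewrite /yt /g /h /dot !coordE; ring.
have [k0 Ik0] := spread_dot (dot nu (x i)) nu0;
  rewrite -subr_gt0 -dotBr -/(h k0) => hk0.
pose s0 := g k0 / (2 * h k0).
pose A := [set k | [/\ I k, 0 < h k & g k / (2 * h k) <= s0]].
have fA : finite_set A.
  apply: sub_finite_set (lf (enorm (yt s0) + enorm (yt s0 - x i))) => k [Ik hk].
  rewrite ler_pdivrMr ?mulr_gt0 // => gk; split=> //.
  have : enorm (yt s0 - x k) <= enorm (yt s0 - x i).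
    by rewrite le_enorm -subr_le0 power; lra.
  have := enorm_tri (x k) (yt s0) 0; rewrite !subr0 enormC; lra.
have [k [Ik hk ks] Hk] := argmin_finite (fun k =>
  g k / (2 * h k)) fA (And3 Ik0 hk0 (lexx _)).
pose s := g k / (2 * h k).
have s_ge0 : 0 <= s by rewrite divr_ge0 ?g0 // mulr_ge0 // ltW.
have nneg l : I l -> 0 <= g l - 2 * s * h l.
  move=> Il; have [hl|hl] := leP (h l) 0.
    by have := g0 _ Il; have := mulr_ge0_le0 s_ge0 hl; nra.
  have : s <= g l / (2 * h l).
    have [ls|/ltW ls] := leP (g l / (2 * h l)) s0; first by apply: Hk; split.
    exact: le_trans ls.
  by rewrite ler_pdivlMr ?mulr_gt0 // subr_ge0 mulrCA -mulrA.
have ji : h j = 0 by rewrite /h /nu /perp /dot /=; ring.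
have gj : g j = 0.
  rewrite /g; have -> : dot (y - x j) (y - x j) = dot (y - x i) (y - x i).
    by rewrite -!enorm_sqr (jc_equidistant Ii Ij).
  by rewrite subrr.
have zero l : g l - 2 * s * h l = 0 -> jc l (yt s).
  move=> E n In; rewrite /wdist !addr0 le_enorm.
  by have := nneg _ In; rewrite -!power in E *; lra.
exists k, (yt s); split=> //; split; apply: zero.
- by rewrite /g /h !subrr /dot /= !mulr0 addr0 mulr0 subrr.
- by rewrite gj ji mulr0 subrr.
- by rewrite /s; field; rewrite gt_eqF.
Qed.

Lemma tame_delaunay : tame (delaunay I x).
Proof.
have ce ij : edge ij -> closed (segment (x ij.1) (x ij.2)) by move=> _;
  exact: closed_segment.
have [closedS denseS] : closed (delaunay I x) /\ dense (~` delaunay I x).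
  rewrite delaunayE; split; first exact: locfin_closed edge_locfin.
  apply: locfin_dense => // [|[i j] _ /=]; first exact: edge_locfin.
  pose n : plane := if x i == x j then (1, 0) else perp (x i - x j).
  have n0 : n != 0.
    rewrite /n; case: ifPn => [_|ne]; last by apply: perp_neq0; rewrite subr_eq0.
    by apply/eqP => -[] /eqP; rewrite oner_eq0.
  rewrite -subset0 -(line_interior0 (dot n (x j)) n0);
    apply: interiorS => z [s _ ->] /=.
  rewrite /n; case: eqP => [->|_]; first by rewrite -scalerDl addrC subrK scale1r.
  by rewrite /perp /dot !coordE /=; ring.
split=> //; exists (x @` I); split.
  apply: sub_finite_set (finite_image x (lf 1)) => _ [[n In <-] x1].
  by exists n.
move=> z; rewrite {1}delaunayE =>
  -[[i j] [/= Ii Ij [y [_ iy jy]]] [s /andP[s0 s1] zE]] zV.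
have ne : x i <> x j.
  move=> E; apply: zV; exists i => //; rewrite zE -E.
  by rewrite -scalerDl addrC subrK scale1r.
have sn0 : s != 0.
  by apply: contra_not_neq zV => E; exists j => //;
    rewrite zE E scale0r add0r subr0 scale1r.
have sn1 : s != 1.
  by apply: contra_not_neq zV => E; exists i => //;
    rewrite zE E subrr scale0r addr0 scale1r.
have [k [y' [Ik hk [iy' jy' ky']]]] := pencil Ii Ij ne iy jy.
have Vy' : voronoi I x y' by exact: (voronoi_in Ii Ij).
have E a b : I a -> I b -> jc a y' -> jc b y' -> segment (x a) (x b) `<=` delaunay I x.
  move=> Ia Ib ay yb u uab; rewrite delaunayE; exists (a, b) => //.
  by split=> //; exists y'.
apply: (triangle_supported_side (p := x i) (q := x j) (v := x k)) => //; try exact: E.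
by exists s => //; rewrite !lt_neqAle s0 s1 eq_sym sn0 sn1.
Qed.

End Configuration.
End Delaunay.

(** * Almost sure regularity of the basic tessellations *)

Section AlmostSure.
Context d (Omega : measurableType d) (R : realType) (P : probability Omega R).
Local Notation plane := (R * R)%type.

Section Dominated.
Variable mu : probability R R.

Let toR (r : R) : measurableTypeR R := r.

Let measurable_toR : measurable_fun setT toR.
Proof. by move=> _ A mA; rewrite setTI; exact: mA. Qed.

HB.instance Definition _ := isMeasurableFun.Build _ _ _ _ toR measurable_toR.

(** The absolute continuity in its epsilon-delta form, for the variation of the
    charge associated with [mu]. The law is transported by the identity because
    the two sigma-algebras of the reals are equal but not presented in the same
    way. *)
Lemma dominated_small (e : R) : mu `<< lebesgue_measure -> 0 < e ->
  exists2 h : R, 0 < h & forall a, (mu `[a, (a + 2 * h)%R]%classic <= e%:E)%E.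
Proof.
move=> mul e0.
pose nu := charge_of_finite_measure (distribution mu toR).
have [A [N pn]] := Hahn_decomposition nu.
have nul : nu `<< @lebesgue_measure R.
  move=> B HB C mC CB; exact: (mul B HB C mC CB).
have [r [r0 re]] := charge_variation_continuous pn nul e0.
exists (r / 4) => [|a]; first by rewrite divr_gt0.
pose J : set (measurableTypeR R) := `[a, a + 2 * (r / 4)]%classic.
have mJ : measurable J by exact: measurable_itv.
have small : (lebesgue_measure J < r%:E)%E.
  rewrite /J lebesgue_measure_itv /= lte_fin ifT; last lra.
  by rewrite -EFinD lte_fin; lra.
apply: ltW; apply: le_lt_trans (re _ mJ small).
by apply: le_trans (abse_charge_variation pn mJ); exact: lee_abs.
Qed.
End Dominated.

(** Applied twice below, to the grid cells of a mark and to those of a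
    distance. *)
Lemma le_partition (X : set Omega) (B : nat -> set Omega) (c : R) :
  measurable X -> (forall l, measurable (B l)) -> trivIset setT B ->
  X `<=` \bigcup_l B l -> 0 <= c ->
  (forall l, P (X `&` B l) <= c%:E * P (B l))%E -> (P X <= c%:E)%E.
Proof.
move=> mX mB tB XB c0 H.
apply: (@le_trans _ _ (\sum_(0 <= l <oo) P (X `&` B l))%E).
  apply: measure_sigma_subadditive => //; first by move=> l; exact: measurableI.
  by rewrite -setI_bigcupr => w Xw; split=> //; exact: XB.
apply: (@le_trans _ _ (\sum_(0 <= l <oo) c%:E * P (B l))%E).
  by apply: lee_nneseries => l _.
rewrite nneseriesZl //.
rewrite -measure_semi_bigcup //; last exact: bigcupT_measurable.
rewrite -[leRHS]mule1; apply: lee_wpmul2l; first by rewrite lee_fin.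
exact: probability_le1 (bigcupT_measurable _ mB).
Qed.

Lemma enorm_sub_measurable d' (T : measurableType d') (f g : T -> plane) :
  measurable_fun setT f -> measurable_fun setT g ->
  measurable_fun setT (fun w => enorm (f w - g w)).
Proof.
move=> mf mg; rewrite /enorm.
apply: (measurableT_comp (f := @Num.sqrt R)).
  by apply: continuous_measurable_fun; exact: sqrt_continuous.
apply: measurable_funD; apply: measurable_funX; apply: measurable_funB.
- exact: (measurableT_comp measurable_fst mf).
- exact: (measurableT_comp measurable_fst mg).
- exact: (measurableT_comp measurable_snd mf).
- exact: (measurableT_comp measurable_snd mg).
Qed.

Section Marks.
Variables (X : point_family Omega plane) (T : nat -> Omega -> R) (mu : probability R R).
Hypothesis iid : iid_marks P X T mu.
Hypothesis mul : mu `<< lebesgue_measure.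

Let cellh (h : R) (f : Omega -> R) (k : nat) : set Omega :=
  f @^-1` `[k%:R * h, k.+1%:R * h[%classic.

Let cellh_triv h f : 0 < h -> trivIset setT (cellh h f).
Proof.
move=> h0 k l _ _ [w []]; rewrite /cellh /= !in_itv /= => /andP[k1 k2] /andP[l1 l2].
have := le_lt_trans k1 l2; have := le_lt_trans l1 k2.
rewrite !ltr_pM2r // !ltr_nat !ltnS => lk kl.
by apply/eqP; rewrite eqn_leq lk kl.
Qed.

Let cellh_cover h f : 0 < h -> (forall w, 0 <= f w) -> setT `<=` \bigcup_k cellh h f k.
Proof.
move=> h0 f0 w _; have fh : 0 <= f w / h by rewrite divr_ge0 // ltW.
exists (Num.truncn (f w / h)) => //; rewrite /cellh /= in_itv /=.
by rewrite -ler_pdivlMr // -ltr_pdivrMr // truncn_itv.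
Qed.

Lemma marks_eq_measurable i j :
  measurable [set w | T i w = T j w + enorm (pt X i w - pt X j w)].
Proof.
have [T0 mT lT ind] := iid.
pose D w := enorm (pt X i w - pt X j w).
have mD : measurable_fun setT D.
  by apply: enorm_sub_measurable; exact: measurable_pt.
set N := [set w | _].
have -> : N = (fun w => T i w - (T j w + D w)) @^-1` [set 0].
  by apply/seteqP; split=> w /= /eqP; rewrite ?subr_eq0 => h; apply/eqP;
    rewrite ?subr_eq0.
rewrite -[X in measurable X]setTI; apply: measurable_funB => //.
exact: measurable_funD.
Qed.

(** On a grid of mesh [h] for [T j] and for the distance, the mark [T i] is
    confined to an interval of length [2 h]; by independence the probability is
    at most the largest mass that the law of the marks gives to such an
    interval. *)
Lemma marks_eq_null i j : i != j ->
  P [set w | T i w = T j w + enorm (pt X i w - pt X j w)] = 0%E.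
Proof.
move=> ij; have [T0 mT lT ind] := iid.
pose D w := enorm (pt X i w - pt X j w).
have D0 w : 0 <= D w by exact: enorm_ge0.
pose G := [set B | exists n, B = [set w | idx X w n]] `|`
      [set B | exists n A, measurable A /\ B = pt X n @^-1` A].
pose OG := g_sigma_algebraType G.
have mpt n : measurable_fun (setT : set OG) (pt X n).
  move=> _ A mA; rewrite setTI; apply: sub_sigma_algebra; right; by exists n, A.
have mDG : measurable_fun (setT : set OG) (D : OG -> R).
  exact: enorm_sub_measurable (mpt i) (mpt j).
have mD : measurable_fun setT D.
  by apply: enorm_sub_measurable; exact: measurable_pt.
set N := [set w | _].
have mN : measurable N by exact: marks_eq_measurable.
apply/eqP; rewrite eq_le measure_ge0 andbT.
apply/lee_addgt0Pr => e e0; rewrite add0e.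
have [h h0 Hh] := dominated_small mul e0.
have mc f k : measurable_fun setT f -> measurable (cellh h f k).
  by move=> mf; rewrite -[cellh _ _ _]setTI; apply: mf => //; exact: measurable_itv.
apply: (le_partition (B := cellh h (T j))) => //.
- by move=> l; exact: mc.
- exact: cellh_triv.
- by apply: subset_trans (cellh_cover h0 (T0 j)).
- exact: ltW.
move=> k; have Pk : P (cellh h (T j) k) = (fine (P (cellh h (T j) k)))%:E.
  by rewrite fineK // fin_num_measure //; exact: mc.
rewrite Pk -EFinM.
apply: (le_partition (B := cellh h D)) => //.
- by apply: measurableI => //; exact: mc.
- by move=> l; exact: mc.
- exact: cellh_triv.
- by apply: subset_trans (cellh_cover h0 D0).
- by rewrite mulr_ge0 ?fine_ge0 // ltW.
move=> l; rewrite EFinM -Pk.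
pose a := (k + l)%:R * h.
pose E (o : option nat) : set Omega :=
  if o is Some n then (if n == j then cellh h (T j) k else T i @^-1` `[a,
    a + 2 * h]%classic)
  else cellh h D l.
have := ind [:: Some i; Some j; None] E.
rewrite !big_cons big_nil mule1 => HE.
have -> : (e%:E * P (cellh h (T j) k) * P (cellh h D l) =
          e%:E * (P (E (Some j)) * P (E None)))%E by rewrite /E eqxx muleA.
apply: (@le_trans _ _ (P (E (Some i)) * (P (E (Some j)) * P (E None)))%E); last first.
  apply: lee_wpmul2r; first by rewrite mule_ge0.
  by rewrite /E (negbTE ij) lT //; exact: Hh.
rewrite -HE; first last.
- move=> o; rewrite !inE => /or3P[] /eqP ->; rewrite /E ?(negbTE ij) ?eqxx.
  + exists `[a, a + 2 * h]%classic; first exact: measurable_itv.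
    by rewrite setTI.
  + exists `[k%:R * h, k.+1%:R * h[%classic; first exact: measurable_itv.
    by rewrite setTI.
  + have := mDG measurableT `[l%:R * h, l.+1%:R * h[%classic (measurable_itv _).
    by rewrite setTI.
- by rewrite /= !inE /= orbF andbT; apply: contra ij => /eqP[->].
have mE o : measurable (E o).
  case: o => [n|]; rewrite /E; last exact: mc.
  case: eqP => _; first exact: mc.
  rewrite -[X in measurable X]setTI; apply: mT => //; exact: measurable_itv.
apply: le_measure; rewrite ?inE.
- by apply: measurableI; [apply: measurableI|]; [|exact: mc|exact: mc].
- by apply: fin_bigcap_measurable => //; exact: finite_seq.
move=> w [[Nw kw] lw] o /=; rewrite !inE => /or3P[] /eqP ->;
  rewrite /E ?(negbTE ij) ?eqxx //.
move: Nw kw lw; rewrite /N /cellh /= !in_itv /= -/(D w) => -> /andP[k1 k2] /andP[l1 l2].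
rewrite /a natrD; apply/andP; split; first by rewrite mulrDl lerD.
by move: k2 l2; rewrite -!natr1 => k2 l2; lra.
Qed.

Lemma marks_neq_negligible i j : i != j ->
  P.-negligible [set w | enorm (pt X i w - pt X j w) = `|T i w - T j w|].
Proof.
have mN k l : k != l -> P.-negligible [set w | T k w =
  T l w + enorm (pt X k w - pt X l w)].
  move=> kl; exists [set w | T k w = T l w + enorm (pt X k w - pt X l w)].
  split=> //; [|exact: marks_eq_null].
  exact: marks_eq_measurable.
move=> ij; apply: (negligibleS _ (negligibleU (mN _ _ ij) (mN j i _)));
  last by rewrite eq_sym.
move=> w /= E; have [le|le] := leP (T j w) (T i w).
  by left; rewrite /= E ger0_norm ?subr_ge0 // addrC subrK.
by right; rewrite /= enormC E ltr0_norm ?subr_lt0 // opprB addrC subrK.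
Qed.

Lemma ae_nondegenerate :
  {ae P, forall w, nondegenerate (idx X w) (pt X ^~ w) (T ^~ w)}.
Proof.
pose N (i j : nat) := if i == j then set0 else
  [set w | enorm (pt X i w - pt X j w) = `|T i w - T j w|].
have nN : P.-negligible (\bigcup_i \bigcup_j N i j).
  apply: negligible_bigcup => i; apply: negligible_bigcup => j; rewrite /N.
  case: eqVneq => [_|ij]; first exact: negligible_set0.
  exact: marks_neq_negligible.
apply: negligibleS nN => w /= /existsNP[i] /existsNP[j] /not_implyP[_] /not_implyP[_].
move=> /not_implyP[ne] /negP; rewrite negbK => /eqP E.
exists i => //; exists j => //; rewrite /N; case: eqVneq => // ij.
by move: ne; rewrite ij eqxx.
Qed.
End Marks.

(** The probability that a translate of a quadrant is empty does not depend on
    the translation. The quadrants increase to the plane, so it equals the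
    probability that the configuration is empty, an event contained in the
    former. *)
Lemma ae_spread (X : point_family Omega plane) (lambda : \bar R) :
  point_process2 P X lambda ->
  {ae P, forall w, idx X w !=set0 -> spread (idx X w) (pt X ^~ w)}.
Proof.
move=> [_ stat _].
pose Q (b1 b2 : bool) (a : R) : set plane :=
  [set p | a <= (-1) ^+ b1 * p.1 /\ a <= (-1) ^+ b2 * p.2].
pose V b1 b2 a := [set w | forall n, idx X w n -> ~ Q b1 b2 a (pt X n w)].
have mQ b1 b2 a : measurable (Q b1 b2 a).
  have m1 b : measurable_fun setT (fun p : plane => (-1) ^+ b * p.1).
    exact: measurable_funM.
  have m2 b : measurable_fun setT (fun p : plane => (-1) ^+ b * p.2).
    exact: measurable_funM.
  apply: measurableI.
  - have := m1 b1 measurableT `[a, +oo[%classic (measurable_itv _); rewrite setTI.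
    by congr measurable; apply/seteqP; split=> p; rewrite /= in_itv /= andbT.
  - have := m2 b2 measurableT `[a, +oo[%classic (measurable_itv _); rewrite setTI.
    by congr measurable; apply/seteqP; split=> p; rewrite /= in_itv /= andbT.
have VE b1 b2 a : V b1 b2 a = [set w | npts R X (Q b1 b2 a) w = 0%:R%:E].
  apply/seteqP; split=> w /= H.
    rewrite /npts (_ : [set n | _] = set0) ?measure0 //.
    by rewrite -subset0 => n [nw Qn]; exact: (H n).
  move=> n nw Qn; move: H; rewrite /npts /counting; case: ifP => // /asboolP fin.
  move=> [] /eqP; rewrite pnatr_eq0 finmap.cardfs_eq0 => /eqP E.
  have : [set n | idx X w n /\ Q b1 b2 a (pt X n w)] = set0 by exact: fset_set_set0.
  by rewrite -subset0 => /(_ n); apply.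
have mV b1 b2 a : measurable (V b1 b2 a).
  have -> : V b1 b2 a = \bigcap_n ~` ([set w | idx X w n] `&` pt X n @^-1` (Q b1 b2 a)).
    by apply/seteqP; split=> w H n; have := H n => H';
      [move=> _ [/H']|move=> nw Qn; apply: H'].
  apply: bigcapT_measurable => n; apply: measurableC; apply: measurableI;
    first exact: measurable_idx.
  by rewrite -[X in measurable X]setTI; exact: measurable_pt.
have shift b1 b2 a : P (V b1 b2 a) = P (V b1 b2 0).
  have := stat ((-1) ^+ b1 * a, (-1) ^+ b2 * a) 1%N (fun=> Q b1 b2 0) (fun=>
    0%N) (fun=> mQ _ _ _).
  have one : forall x : \bar R, forall f : Omega -> \bar R,
      [set w | forall j : 'I_1, f w = x] = [set w | f w = x].
    by move=> x f; apply/seteqP; split=> w /= => [/(_ ord0)|].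
  rewrite !one -!VE => <-; congr (P _); rewrite VE; congr [set w | npts R X _ w = _].
  have s2 (b : bool) : (-1) ^+ b * (-1) ^+ b = 1 :> R by rewrite -expr2 sqrr_sign.
  apply/funext => _; apply/seteqP; split=> p /=.
    move=> [p1 p2]; exists (p - ((-1) ^+ b1 * a, (-1) ^+ b2 * a));
      last by rewrite subrK.
    rewrite /Q /= !mulrBr !mulrA !s2 !mul1r !subr_ge0.
    by split.
  move=> [q [q1 q2] <-]; rewrite /Q /=.
  by rewrite !mulrDr !mulrA !s2 !mul1r !lerDr.
pose E0 := [set w | idx X w = set0].
have limV b1 b2 : P (V b1 b2 0) = P E0.
  have EV : \bigcap_n V b1 b2 (- n%:R) = E0.
    apply/seteqP; split=> w /=; last by move=> E n _ k; rewrite /= E.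
    move=> H; rewrite /E0 /= -subset0 => k kw.
    set p := pt X k w.
    pose n := (Num.truncn (`|p.1| + `|p.2|)).+1.
    apply: (H n I k kw); rewrite -/p.
    have hn : `|p.1| + `|p.2| < n%:R by exact: truncnS_gt.
    have nn (b : bool) (r : R) : `|(-1) ^+ b * r| = `|r| by rewrite normrMsign.
    split; rewrite lerNl; apply: le_trans (ler_norm _) _; rewrite normrN nn.
      by apply: le_trans (ltW hn); rewrite lerDl.
    by apply: le_trans (ltW hn); rewrite lerDr.
  have : P \o (fun n => V b1 b2 (- n%:R)) @ \oo --> P (\bigcap_n V b1 b2 (- n%:R)).
    apply: nonincreasing_cvg_mu => //.
    - by apply: le_lt_trans (probability_le1 _ _) (ltry _); exact: mV.
    - exact: bigcapT_measurable.
    - move=> m n mn; apply/subsetPset => w H k kw [k1 k2]; apply: (H k kw).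
      by split; apply: le_trans; [|exact: k1| |exact: k2]; rewrite lerN2 ler_nat.
  rewrite EV (_ : P \o _ = fun=> P (V b1 b2 0)); last first.
    by apply/funext => n /=; rewrite shift.
  by move/cvg_lim => <- //; rewrite lim_cst.
have nV b1 b2 a : P.-negligible (V b1 b2 a `\` E0).
  have mE0 : measurable E0.
    have -> : E0 = \bigcap_n ~` [set w | idx X w n].
      apply/seteqP; split=> w /=; first by move=> E n _; rewrite /= E.
      by move=> H; rewrite /E0 /= -subset0 => n nw; exact: (H n I).
    by apply: bigcapT_measurable => n; apply: measurableC; exact: measurable_idx.
  apply/negligibleP; first exact: measurableD.
  have EV : E0 `<=` V b1 b2 a by move=> w E n; rewrite E.
  rewrite measureD //; last by apply: le_lt_trans (probability_le1 _ _)
    (ltry _); exact: mV.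
  have PV : P (V b1 b2 a) = P E0 by rewrite shift limV.
  rewrite setIC (setIidl EV); apply: (@eq_trans _ _ (P E0 - P E0)%E).
    by congr (_ - _)%E; exact: PV.
  by rewrite subee // fin_num_measure.
have nB b1 b2 : P.-negligible (\bigcup_(a : nat) (V b1 b2 a%:R `\` E0)).
  by apply: negligible_bigcup => a.
apply: negligibleS (negligibleU (negligibleU (nB true true) (nB true false))
  (negligibleU (nB false true) (nB false false))) => w /= /not_implyP[w0].
move=> /existsNP[a] /existsNP[b1] /existsNP[b2] H.
have Vw : (V b1 b2 a%:R `\` E0) w.
  split; last by move=> E; case: w0 => n; rewrite E.
  by move=> n nw [n1 n2]; apply: H; exists n.
by move: Vw; clear H; case: b1; case: b2 => Vw; [left; left|left; right|right;
  left|right; right]; exists a.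
Qed.

Lemma ae_tame (tau : tess_type R) (S : Omega -> set plane) :
  tess_from P tau S -> {ae P, forall w, tame (S w)}.
Proof.
case: tau => [lambda|lambda|lambda|lambda mu|lh lv] /=.
- move=> [_ [X [[lf _ _] ->]]]; apply: aeW => w.
  rewrite voronoiE; apply: tame_johnson_mehl => //.
  move=> i j _ _ ne; rewrite subrr normr0; apply: contra_neq ne => /enorm_eq0/eqP.
  by rewrite subr_eq0 => /eqP ->.
- move=> [_ [X [pX ->]]]; have [lf _ _] := pX.
  apply: filterS (ae_spread pX) => w H.
  have [/H sp|I0] := pselect (idx X w !=set0).
    by by apply: tame_delaunay.
  have -> : delaunay (idx X w) (pt X ^~ w) = set0.
    by rewrite -subset0 => z [i [j [s [Ii _ _ _ _]]]]; apply: I0; exists i.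
  split; first exact: closed0.
    by rewrite setC0 => O [x Ox] oO; exists x.
  by exists set0; split=> //; rewrite set0I.
- move=> [_ [X [[lf _ _] ->]]]; apply: aeW => w.
  pose I := [set i | idx X w i /\ 0 <= (pt X i w).2 < pi].
  have -> : line_tess (idx X w) (pt X ^~ w) =
     \bigcup_(i in I) [set y | dot (cos (pt X i w).2,
       sin (pt X i w).2) y = (pt X i w).1].
    apply: eq_bigcupr => i _; apply/seteqP.
    by split=> y; rewrite /dot /= (mulrC y.1) (mulrC y.2).
  apply: tame_lines => [i _|r].
    by rewrite /enorm /= cos2Dsin2 sqrtr1.
  apply: sub_finite_set (lf w (r + pi)) => i [[wi /andP[t0 tp]] ir]; split=> //.
  apply: le_trans (enorm_le_l1 _) _; apply: lerD => //.
  by rewrite ger0_norm // ltW.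
- move=> [_ [mul [X [T [[lf _ _] iid ->]]]]].
  apply: filterS (ae_nondegenerate iid mul) => w nd.
  have [T0 _ _ _] := iid.
  by apply: tame_johnson_mehl.
- move=> [Yh [Yv [[[lfh _ _] _] [[lfv _ _] _] _ ->]]]; apply: aeW => w.
  pose I : set (nat + nat) := [set k | match k with inl i => idx Yh w i | inr i =>
    idx Yv w i end].
  pose a (k : nat + nat) : plane := if k is inl _ then (0, 1) else (1, 0).
  pose b (k : nat + nat) : R := match k with inl i =>
    pt Yh i w | inr i => pt Yv i w end.
  have -> : manhattan (idx Yh w) (pt Yh ^~ w) (idx Yv w) (pt Yv ^~ w) =
     \bigcup_(i in I) [set y | dot (a i) y = b i].
    apply/seteqP; split=> z.
      move=> [[i Ii /= zi]|[i Ii /= zi]]; [exists (inl i) => //|exists (inr i) => //].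
        by rewrite /dot /= mul0r mul1r add0r.
      by rewrite /dot /= mul0r mul1r addr0.
    move=> [[i|i] /= Ii]; rewrite /dot /= mul0r mul1r ?add0r ?addr0 => zi;
      [left|right]; by exists i.
  apply: tame_lines => [[i|i] _|r].
  - by rewrite /enorm /= expr0n expr1n add0r sqrtr1.
  - by rewrite /enorm /= expr0n expr1n addr0 sqrtr1.
  have f1 := finite_image (@inl nat nat) (lfh w r).
  have f2 := finite_image (@inr nat nat) (lfv w r).
  have f3 := conj f1 f2; rewrite -finite_setU in f3; apply: sub_finite_set f3.
  by move=> [i|i] [/= Ii ir]; [left|right]; exists i.
Qed.
End AlmostSure.

(** * Integrals of functions that need not be measurable *)

Section LowerIntegral.
Context d (T : measurableType d) (R : realType).
Variable mu : {measure set T -> \bar R}.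
Local Open Scope ereal_scope.

Lemma integral_le_nonmeasurable (f g : T -> \bar R) : (forall w, 0 <= f w) ->
  (forall w, f w <= g w) -> \int[mu]_w f w <= \int[mu]_w g w.
Proof.
move=> f0 fg; have g0 w : 0 <= g w by apply: le_trans (fg w).
rewrite !ge0_integralTE //; apply: ereal_sup_le => _ [h hf <-].
by exists h => // w; apply: le_trans (fg w).
Qed.

(** The integral of a nonnegative function is the supremum over the simple
    functions below it, hence monotone without measurability; here only the
    smaller function is measurable. *)
Lemma ae_le_integral_lower (h f : T -> \bar R) : measurable_fun setT h ->
  (forall w, 0 <= h w) -> (forall w, 0 <= f w) ->
  {ae mu, forall w, h w <= f w} -> \int[mu]_w h w <= \int[mu]_w f w.
Proof.
move=> mh h0 f0 [N [mN N0 HN]].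
rewrite (ge0_negligible_integral mN) //.
rewrite integral_mkcond; apply: integral_le_nonmeasurable => w.
  by apply: erestrict_ge0.
rewrite patchE; case: ifPn => // wN.
apply: contrapT => H; move: wN; rewrite setTD inE; apply; apply: HN.
exact: H.
Qed.

(** On the exceptional null set the larger function can be raised to infinity
    without changing its integral. *)
Lemma ae_le_integral_upper (f h : T -> \bar R) : measurable_fun setT h ->
  (forall w, 0 <= h w) -> (forall w, 0 <= f w) ->
  {ae mu, forall w, f w <= h w} -> \int[mu]_w f w <= \int[mu]_w h w.
Proof.
move=> mh h0 f0 [N [mN N0 HN]].
pose g w := h w + +oo * (\1_N w)%:E.
have mg : measurable_fun setT g.
  apply: emeasurable_funD => //; apply: emeasurable_funM => //.
  by apply/measurable_EFinP; exact: measurable_indic.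
have g0 w : 0 <= g w by rewrite adde_ge0 // mule_ge0 // lee_fin.
apply: (@le_trans _ _ (\int[mu]_w g w)).
  apply: integral_le_nonmeasurable => // w; rewrite /g indicE.
  have [_|wN] := boolP (w \in N).
    by rewrite mule1 addey ?leey // gt_eqF // (lt_le_trans _ (h0 w)) ?ltNy0.
  rewrite mule0 adde0; apply: contrapT => H; move/negP: wN; rewrite inE; apply.
  by apply: HN.
rewrite (_ : \int[mu]_w g w = \int[mu]_w h w) //.
apply: ge0_ae_eq_integral => //; exists N; split=> // w /= /not_implyP[_ H].
by apply: contrapT => wN; apply: H; rewrite /g indicE memNset // mule0 adde0.
Qed.

(** For the lower integral, like the two comparisons above. *)
Lemma infinite_null (f : T -> \bar R) (D : set T) : measurable D ->
  (forall w, 0 <= f w) -> (forall w, D w -> f w = +oo) ->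
  \int[mu]_w f w < +oo -> mu D = 0.
Proof.
move=> mD f0 fD fi; apply: contrapT => /eqP D0.
have : \int[mu]_(w in D) (cst +oo) w <= \int[mu]_w f w.
  rewrite integral_mkcond; apply: integral_le_nonmeasurable => w; rewrite patchE.
    by case: ifPn => // _; rewrite /cst leey.
  by case: ifPn => //; rewrite inE => /fD ->.
by rewrite integral_cst // gt0_mulye ?lt0e ?D0 //= leye_eq => /eqP E; rewrite E in fi.
Qed.

End LowerIntegral.

Section Series.
Variable R : realType.
Local Open Scope ereal_scope.

Lemma nneseriesZ (f : nat -> \bar R) (c : \bar R) : (forall k, 0 <= f k) -> 0 <= c ->
  \sum_(k <oo) c * f k = c * \sum_(k <oo) f k.
Proof.
move=> f0 c0; rewrite -!ge0_integral_count //; last by move=> k; rewrite mule_ge0.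
by rewrite ge0_integralZl.
Qed.

(** Used for series of indicators of disjoint events, of which one term at most
    is nonzero. *)
Lemma nneseries_le_single (f : nat ->
  \bar R) k0 (c : \bar R) : (forall k, 0 <= f k) -> 0 <= c ->
  (forall k, k != k0 -> f k = 0) -> f k0 <= c -> \sum_(k <oo) f k <= c.
Proof.
move=> f0 c0 fk fc; apply: lime_le; first by apply: is_cvg_nneseries.
apply: nearW => n.
have [kn|nk] := ltnP k0 n.
  rewrite big_mkord (bigD1 (Ordinal kn)) //= big1 ?adde0 // => i ik.
  by apply: fk; apply: contra ik => /eqP E; apply/eqP/val_inj.
by rewrite big_nat big1 // => i /andP[_ ik]; apply: fk;
  rewrite ltn_eqF // (leq_trans ik).
Qed.

Lemma nneseries_ge_single (f : nat -> \bar R) k0 : (forall k, 0 <= f k) ->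
  f k0 <= \sum_(k <oo) f k.
Proof.
move=> f0; apply: (@le_trans _ _ (\sum_(0 <= k < k0.+1) f k)).
  by rewrite big_nat_recr //= leeDr // sume_ge0.
by apply: nneseries_lim_ge.
Qed.

(** The tangent to the exponential at [t x] lies below its graph, at the points
    0 and [x]. *)
Lemma expR_convex (t x : R) : (0 <= t <= 1 -> expR (t * x) <= 1 - t + t * expR x)%R.
Proof.
move=> /andP[t0 t1]; set y := (t * x)%R.
have h1 : (expR y * (1 + (x - y)) <= expR x)%R.
  by rewrite -[X in (_ <= expR X)%R](subrKC y) expRD ler_pM2l ?expR_gt0 // expR_ge1Dx.
have h2 : (expR y * (1 - y) <= 1)%R.
  by rewrite -[leRHS]expR0 -[X in (_ <=
    expR X)%R](subrr y) expRD ler_pM2l ?expR_gt0 // expR_ge1Dx.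
have h3 : (t * (expR y * (1 + (x - y))) + (1 - t) * (expR y * (1 - y)) = expR y)%R.
  by rewrite /y; ring.
rewrite -h3 addrC; apply: lerD; last by rewrite ler_wpM2l.
by rewrite -[leRHS]mulr1 ler_wpM2l // subr_ge0.
Qed.

End Series.

(** * Exponential moments of the nested tessellation *)

Section Levels.
Variable R : realType.
Local Notation plane := (R * R)%type.

Lemma short_mono k l (T : set plane) : (k <= l)%N -> short k T -> short l T.
Proof.
move=> kl H n; have [s /andP[s1 s2] Ts] := H n; exists s => //.
by rewrite /good_list s1 /=; apply: lt_le_trans s2 _; rewrite ler_nat.
Qed.

Lemma short0 (T : set plane) : ~ short 0 T.
Proof.
move=> /(_ 0%N)[s /andP[/allP s1 s2] _]; move: s2; rewrite ltNge => /negP; apply.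
by rewrite big_seq sumr_ge0 // => b /s1 /andP[/ltW].
Qed.

(** The sets whose discretised length in the disk is [k + 1]. *)
Definition level (k : nat) : set (set plane) := short k.+1 `\` short k.

Lemma hit_level k : hit_algebra (R := R) (level k).
Proof.
pose G := [set B | exists2 K : set plane, compact K & B = [set T | T `&` K !=set0]].
have m j : measurable (short j : set (g_sigma_algebraType G)) by exact: hit_short.
suff : measurable (level k : set (g_sigma_algebraType G)) by [].
exact: measurableD.
Qed.

Lemma level_uniq k l (T : set plane) : level k T -> level l T -> k = l.
Proof.
wlog kl : k l / (k <= l)%N.
  by move=> H kT lT; case: (leqP k l) => [|/ltnW] kl; [|apply/esym]; exact: H.
move=> [k1 _] [_ l0]; apply/eqP; rewrite eqn_leq kl leqNgt; apply/negP => lt.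
by apply: l0; apply: short_mono k1.
Qed.

Lemma level_ex (T : set plane) : (exists k, short k T) -> exists k, level k T.
Proof.
move=> [k]; elim: k => [/short0//|k IH kT].
by have [/IH//|nk] := pselect (short k T); exists k.
Qed.

End Levels.

Section Moments.
Context (R : realType) d (Omega : measurableType d) (P : probability Omega R).
Local Notation plane := (R * R)%type.
Variables (tauo tau' : tess_type R) (So : Omega -> set plane) (J : Omega -> set nat)
  (C : Omega -> nat -> set plane) (S : nat -> Omega ->
    set plane) (S' : Omega -> set plane).
Hypotheses (hSo : basic_tessellation P tauo So) (hC : cell_enumeration So J C)
  (hS' : basic_tessellation P tau' S')
  (hS : forall i, basic_tessellation P tau' (S i) /\ same_law P (S i) S').

Let Fam := (fun o : option nat =>
       if o is Some i then sigma_set (S i) else sigma_first_layer So J C).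
Hypothesis hind : mutually_independent P Fam.

Let cellhit n := [set w | J w n /\ C w n `&` @B1 R !=set0].
Let cells_are (s : seq nat) := [set w | [set n | J w n /\
  C w n `&` @B1 R !=set0] = [set` s]].

(** A cell is open, so it meets the closed disk if and only if it meets the
    open one; the events of the first layer are about open sets. *)
Let cellhitE n : cellhit n = [set w | J w n /\
  C w n `&` [set x : plane | enorm x < 1] !=set0].
Proof.
apply/seteqP; split=> w [Jn [p [Cp p1]]]; split=> //; last by exists p;
  split=> //; exact: ltW.
have [_ _ oC _ _] : is_cell (So w) (C w n) by have [+ _ _] := hC.1 w; apply.
have : closure [set x : plane | enorm x < 1] p.
  apply: (@closure_ray _ p (- p) _ 1) => // s /andP[s0 s1] /=.
  have -> : p + s *: - p = (1 - s) *: p by rewrite scalerN scalerBl scale1r.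
  rewrite enormZ ger0_norm ?subr_ge0 ?(ltW s1) //.
  by move: p1; rewrite /B1 /=; have := enorm_ge0 p; nra.
have Cn : nbhs p (C w n) by exact: open_nbhs_nbhs.
by move=> /(_ _ Cn)[q [q1 Cq]]; exists q.
Qed.

Let measurable_cells_are s : measurable (cells_are s) /\ Fam None (cells_are s).
Proof.
have E : cells_are s = \bigcap_n (if n \in s then cellhit n else ~` cellhit n).
  apply/seteqP; split=> w /=.
    move=> H n _; case: ifPn => ns.
      by have : [set` s] n by []; rewrite -H.
    by move=> Jn; move/negP: ns; apply; have : [set` s] n by rewrite -H.
  move=> H; apply/seteqP; split=> n /=.
    by move=> Jn; have := H n I; case: ifPn => // _ /(_ Jn).
  by move=> ns; have := H n I; rewrite ns.
pose G := sigma_set So `|`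
      [set B | exists i (G : set plane), open G /\
         B = [set w | J w i /\ C w i `&` G !=set0]].
split.
  rewrite E; apply: bigcapT_measurable => n.
  have mn : measurable (cellhit n) by rewrite cellhitE; apply: hC.2; exact: openB1.
  by case: ifP => _ //; exact: measurableC.
suff : measurable (cells_are s : set (g_sigma_algebraType G)) by [].
rewrite E; apply: bigcapT_measurable => n.
have mn : measurable (cellhit n : set (g_sigma_algebraType G)).
  apply: sub_sigma_algebra; right; exists n, [set x : plane | enorm x < 1].
  by split; [exact: openB1|exact: cellhitE].
by case: ifP => _ //; exact: measurableC.
Qed.

Let Fam_measurable o B : Fam o B -> measurable B.
Proof.
case: o => [i|] /=; first by have [[rS _] _] := hS i; exact: rS.
apply: smallest_sub; first exact: sigma_algebra_measurable.
move=> A [|[i [G [oG ->]]]]; first exact: hSo.1.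
exact: hC.2.
Qed.

Let Ev i k := S i @^-1` (level k).
Let p k := P (S' @^-1` (level k)).

Let Ev_fam i k : Fam (Some i) (Ev i k).
Proof. by exists (level k); [exact: hit_level|rewrite setTI]. Qed.

Let PEv i k : P (Ev i k) = p k.
Proof. by have [_ law] := hS i; apply: law; exact: hit_level. Qed.

Let mEv i k : measurable (Ev i k).
Proof. exact: Fam_measurable (Ev_fam i k). Qed.

Section Product.
Variable a : nat -> R.
Hypothesis a0 : forall k, 0 <= a k.
Local Open Scope ereal_scope.

Let ind (A : set Omega) w : \bar R := (\1_A w)%:E.

Let ind_ge0 A w : 0 <= ind A w. Proof. by rewrite lee_fin. Qed.

Let mind A : measurable A -> measurable_fun setT (ind A).
Proof. by move=> mA; apply/measurable_EFinP; exact: measurable_indic. Qed.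

(** The random variable [a] of the level of [S i], written as a series in order
    to be integrated term by term. *)
Definition level_weight i w : \bar R := \sum_(k <oo) (a k)%:E * ind (Ev i k) w.

Let term_ge0 i k w : 0 <= (a k)%:E * ind (Ev i k) w.
Proof. by rewrite mule_ge0 // lee_fin. Qed.

Let level_weight_ge0 i w : 0 <= level_weight i w.
Proof. by apply: nneseries_ge0 => k _ _. Qed.

Let measurable_level_weight i : measurable_fun setT (level_weight i).
Proof.
apply: ge0_emeasurable_sum => [k w _ _|k _]; first exact: term_ge0.
by apply: emeasurable_funM => //; exact: mind.
Qed.

(** The expectation of [a] at the level of [S']. *)
Definition level_moment : \bar R := \sum_(k <oo) (a k)%:E * p k.

Let prod_ge0 (I : Type) (s : seq I) (f : I -> \bar R) : (forall i, 0 <= f i) ->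
  0 <= \prod_(i <- s) f i.
Proof. by move=> f0; elim/big_ind : _ => // *; exact: mule_ge0. Qed.

Let measurable_prod (I : eqType) (s : seq I) (f : I -> Omega -> \bar R) :
  (forall i, i \in s -> measurable_fun setT (f i)) ->
  measurable_fun setT (fun w => \prod_(i <- s) f i w).
Proof.
elim: s => [|i s IH] H.
  by under eq_fun do rewrite big_nil; exact: measurable_cst.
under eq_fun do rewrite big_cons.
apply: emeasurable_funM; first by apply: H; exact: mem_head.
by apply: IH => j js; apply: H; rewrite inE js orbT.
Qed.

Let prod_ind (s : seq (option nat)) (F : option nat -> set Omega) w :
  \prod_(o <- s) ind (F o) w = ind (\bigcap_(o in [set` s]) F o) w.
Proof.
rewrite /ind indicE; have [wI|/negP H] := boolP (w \in \bigcap_(o in [set` s]) F o).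
  by rewrite big_seq big1 // => o os; rewrite indicE mem_set //; exact: (set_mem wI).
have [j os Fo] : exists2 o, o \in s & ~ F o w.
  apply: contrapT => N; apply: H; apply/mem_set => o /= os.
  by apply: contrapT => Fo; apply: N; exists o.
by rewrite (big_rem j) //= {1}indicE memNset // mul0e.
Qed.

(** The functions [level_weight i] are series of multiples of indicators of
    events of the family; they are replaced by these indicators one at a time,
    which reduces the product formula to the independence of events. *)
Lemma integral_independent (s1 : seq nat) (s2 : seq (option nat))
    (F : option nat -> set Omega) :
  uniq (map Some s1 ++ s2) -> (forall o, o \in s2 -> Fam o (F o)) ->
  \int[P]_w (\prod_(i <- s1) level_weight i w * \prod_(o <- s2) ind (F o) w) =
  \prod_(i <- s1) level_moment * \prod_(o <- s2) P (F o).
Proof.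
elim: s1 s2 F => [|i s1 IH] s2 F.
  rewrite /= => u2 HF.
  under eq_integral do rewrite big_nil mul1e prod_ind.
  have mcap : measurable (\bigcap_(o in [set` s2]) F o).
    apply: fin_bigcap_measurable => [|o os]; first exact: finite_seq.
    exact: Fam_measurable (HF _ os).
  by rewrite big_nil mul1e -hind // (integral_indic _ measurableT) // setIT.
rewrite /= => /andP[i12 u12] HF.
have i2 : Some i \notin s2 by move: i12; rewrite mem_cat negb_or => /andP[].
(* The factor of [i] becomes the indicator of its level [k]. *)
pose F' k o := if o == Some i then Ev i k else F o.
have F'E k o : o \in s2 -> F' k o = F o.
  by move=> os; rewrite /F'; case: eqVneq => // oi; move: i2; rewrite -oi os.
have HF' k o : o \in Some i :: s2 -> Fam o (F' k o).
  rewrite inE /F'; case: eqVneq => [->|_ /= os]; first by move=> _; exact: Ev_fam.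
  exact: HF.
have u' : uniq (map Some s1 ++ Some i :: s2).
  by rewrite -cat1s uniq_catCA cat1s /= i12.
pose Z w := \prod_(i <- s1) level_weight i w * \prod_(o <- s2) ind (F o) w.
have Z0 w : 0 <= Z w by rewrite mule_ge0 // prod_ge0.
have mZ : measurable_fun setT Z.
  apply: emeasurable_funM; first by apply: measurable_prod => j _; exact: measurable_level_weight.
  by apply: measurable_prod => o os; apply: mind; exact: Fam_measurable (HF _ os).
have mE k : measurable_fun setT (fun w => ind (Ev i k) w * Z w).
  by apply: emeasurable_funM => //; exact: mind.
have -> : \int[P]_w (\prod_(j <- i :: s1) level_weight j w * \prod_(o <-
  s2) ind (F o) w) =
    \int[P]_w (\sum_(k <oo) (a k)%:E * (ind (Ev i k) w * Z w)).
  apply: eq_integral => w _; rewrite big_cons -muleA -/(Z w) muleC -nneseriesZ //.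
  by apply: eq_eseriesr => k _; rewrite [LHS]muleC -muleA.
rewrite integral_nneseries //; last 2 first.
- by move=> k; apply: emeasurable_funM.
- by move=> k w _; rewrite mule_ge0 ?lee_fin // mule_ge0.
have IHk k : \int[P]_w ((a k)%:E * (ind (Ev i k) w * Z w)) =
    (\prod_(j <- s1) level_moment * \prod_(o <- s2) P (F o)) * ((a k)%:E * p k).
  rewrite ge0_integralZl //; [|by move=> w _; rewrite mule_ge0|by rewrite lee_fin].
  have E1 : F' k (Some i) = Ev i k by rewrite /F' eqxx.
  have := IH (Some i :: s2) (F' k) u' (HF' k).
  rewrite big_cons E1 PEv.
  have -> : \prod_(o <- s2) P (F' k o) = \prod_(o <- s2) P (F o).
    by apply: eq_big_seq => o os; rewrite F'E.
  have -> : \int[P]_w (\prod_(j <- s1) level_weight j w * \prod_(o <- Some i ::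
    s2) ind (F' k o) w)
     = \int[P]_w (ind (Ev i k) w * Z w).
    apply: eq_integral => w _; rewrite big_cons E1 /Z muleCA; congr (_ * (_ * _)).
    by apply: eq_big_seq => o os; rewrite F'E.
  by move=> ->; rewrite muleCA -[RHS]muleA; congr (_ * _); rewrite muleA muleC.
under eq_eseriesr do rewrite IHk.
rewrite nneseriesZ.
- by rewrite big_cons muleC muleA.
- by move=> k; rewrite mule_ge0 // lee_fin.
- by rewrite mule_ge0 // prod_ge0 // => _; apply: nneseries_ge0 => k _ _;
  rewrite mule_ge0 // lee_fin.
Qed.

End Product.

Let ind (A : set Omega) w : \bar R := (\1_A w)%:E.
Let ind_ge0 A w : (0 <= ind A w)%E. Proof. by rewrite lee_fin. Qed.
Let mind A : measurable A -> measurable_fun setT (ind A).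
Proof. by move=> mA; apply/measurable_EFinP; exact: measurable_indic. Qed.

Lemma edge_length_ge0 (T : Omega -> set plane) A w : (0 <= edge_length T A w)%E.
Proof.
apply: (@le_trans _ _ (hausdorff1_pre 1 (T w `&` A))).
  apply: le_ereal_inf_tmp => _ [U _ <-].
  by apply: nneseries_ge0 => k _ _; exact: ediam_ge0.
by apply: ereal_sup_ubound; exists 1 => //=.
Qed.

Let mlevel' k : measurable (S' @^-1` (level k)).
Proof. by apply: hS'.1; exists (level k); [exact: hit_level|rewrite setTI]. Qed.

Local Notation L' := (edge_length S' (@B1 R)).

(** A closed set of level [k] has length at least [k] in the disk. *)
Lemma levels_moment (c : R) : 0 <= c ->
  (level_moment (fun k => expR (c * k%:R)) <= exp_moment P L' c)%E.
Proof.
move=> c0.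
have e0 k w : (0 <= (expR (c * k%:R))%:E * ind (S' @^-1` (level k)) w)%E.
  by rewrite mule_ge0 // lee_fin expR_ge0.
have me k : measurable_fun setT (fun w =>
  (expR (c * k%:R))%:E * ind (S' @^-1` (level k)) w)%E.
  by apply: emeasurable_funM => //; exact: mind.
have -> : level_moment (fun k => expR (c * k%:R)) =
    (\int[P]_w (\sum_(k <oo) (expR (c * k%:R))%:E * ind (S' @^-1` (level k)) w))%E.
  rewrite integral_nneseries //; apply: eq_eseriesr => k _.
  rewrite ge0_integralZl ?lee_fin ?expR_ge0 //; last exact: mind.
  by rewrite (integral_indic _ measurableT) // setIT.
apply: ae_le_integral_lower.
- by apply: ge0_emeasurable_sum => [k w _ _|k _].
- by move=> w; apply: nneseries_ge0.
- by move=> w; exact: expeR_ge0.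
have := ae_tame hS'.2; apply: filterS => w [cS _ _].
have [[k kw]|nk] := pselect (exists k, level k (S' w)); last first.
  rewrite (_ : (\sum_(k <oo) _)%E = 0%E) ?expeR_ge0 //.
  apply: eseries0 => k _ _; rewrite /ind indicE memNset ?mule0 // => kw.
  by apply: nk; exists k.
apply: (@nneseries_le_single _ _ k) => //; first exact: expeR_ge0.
  move=> j jk; rewrite /ind indicE memNset ?mule0 // => jw.
  by move: jk; rewrite (level_uniq jw kw) eqxx.
rewrite /ind indicE mem_set // mule1.
apply: (@le_trans _ _ (expeR (c%:E * k%:R%:E))); first by rewrite -EFinM.
rewrite lee_expeR; apply: lee_wpmul2l; first by rewrite lee_fin.
rewrite leNgt; apply/negP => /(hausdorff1_short cS).
by case: kw.
Qed.

Let no_level (T : Omega -> set plane) := [set w | forall k, ~ short k (T w)].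

(** A closed set without level has infinite length in the disk, which has
    probability zero for [S'] because its exponential moment is finite. The
    level is determined by the hit-or-miss events, so the law of [S i] gives
    the same. *)
Lemma no_level_null (c : R) i : 0 < c -> (exp_moment P L' c < +oo)%E ->
  P.-negligible (no_level (S i)).
Proof.
move=> c0 fin.
pose G := [set B | exists2 K : set plane, compact K & B = [set T | T `&` K !=set0]].
have hU : hit_algebra (R := R) [set T | forall k, ~ short k T].
  suff : measurable ([set T | forall k,
    ~ short k T] : set (g_sigma_algebraType G)) by [].
  have -> : [set T | forall k, ~ short k T] =
    \bigcap_k ~` (short k : set (g_sigma_algebraType G)).
    by apply/seteqP; split=> T H k; [move=> _; exact: H|exact: (H k I)].
  apply: bigcapT_measurable => k; apply: measurableC; exact: hit_short.
have mU : measurable (no_level S').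
  by apply: hS'.1; exists [set T | forall k, ~ short k T] => //; rewrite setTI.
have mUi : measurable (no_level (S i)).
  by have [[+ _] _] := hS i; apply;
    exists [set T | forall k, ~ short k T] => //; rewrite setTI.
apply/negligibleP => //.
have [_ law] := hS i; rewrite [LHS](law _ hU) -/(no_level S').
have [N [mN N0 HN]] := ae_tame hS'.2.
have UN : P (no_level S' `\` N) = 0%E.
  apply: (infinite_null (f := fun w => expeR (c%:E * L' w)%E)) => //.
  - exact: measurableD.
  - by move=> w; exact: expeR_ge0.
  move=> w [uw Nw]; have [cS _ _] : tame (S' w) by apply: contrapT => H;
    apply: Nw; apply: HN.
  have -> : L' w = +oo%E.
    apply: eq_infty => r; pose k := (Num.truncn `|r|).+1.
    apply: (@le_trans _ _ k%:R%:E).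
      by rewrite lee_fin (le_trans (ler_norm _)) // ltW // truncnS_gt.
    by rewrite leNgt; apply/negP => /(hausdorff1_short cS); exact: uw.
  by rewrite gt0_muley ?lte_fin.
have nU : P.-negligible (no_level S').
  apply: (@negligibleS _ _ _ _ ((no_level S' `\` N) `|` N)).
    by move=> w uw; have [wN|wN] := pselect (N w); [right|left].
  by apply: negligibleU; apply/negligibleP => //; exact: measurableD.
by have /negligibleP := nU; exact.
Qed.

(** The length at level [k] is at most [4 (k + 1)]. *)
Let a (alpha : R) (k : nat) : R := expR (alpha * (4 * k.+1%:R)).

Let V := ncells_B1 J C (R := R).

(** Strictly increasing lists represent finite sets of labels without
    repetition. *)
Let nth_list (n : nat) : option (seq nat) :=
  if pickle_inv n is Some s then if sorted ltn s then Some s else None else None.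

Let nth_listE n s : nth_list n = Some s -> sorted ltn s /\ n = pickle s.
Proof.
rewrite /nth_list; have := @pickle_invK (seq nat) n.
by case: (pickle_inv n) => [t /= <-|//]; case: ifP => // st [<-].
Qed.

Let nth_list_pickle s : sorted ltn s -> nth_list (pickle s) = Some s.
Proof. by move=> st; rewrite /nth_list pickleK_inv st. Qed.

Let infiniteN := ~` \bigcup_s cells_are s.

Let expVge w s : uniq s -> cells_are s w -> ((size s)%:R%:E <= V w)%E.
Proof.
move=> us E; rewrite /V /ncells_B1 E /counting asboolT; last exact: finite_seq.
rewrite lee_fin ler_nat; apply: uniq_leq_size => // i si.
by rewrite in_fset_set ?inE //; exact: finite_seq.
Qed.

(** The number of cells is infinite on this event. *)
Lemma infiniteN_null (beta : R) : 0 < beta -> (exp_moment P V beta < +oo)%E ->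
  P.-negligible infiniteN.
Proof.
move=> b0 fin.
have mI : measurable infiniteN.
  apply: measurableC; apply: countable_bigcupT_measurable; first exact: countableP.
  by move=> s; have [] := measurable_cells_are s.
apply/negligibleP => //.
apply: (infinite_null (f := fun w => expeR (beta%:E * V w)%E)) => //.
  by move=> w; exact: expeR_ge0.
move=> w Nw; rewrite /V /ncells_B1 /counting asboolF.
  by rewrite gt0_muley ?lte_fin.
by move=> /finite_seqP[s E]; apply: Nw; exists s.
Qed.

(** The factor of the first layer, whose edges in the disk have length at most
    [16 + 16 (size s)]. *)
Let first_layer_weight (alpha : R) (s : seq nat) : R :=
  expR (alpha * (16 + 16 * (size s)%:R)).

Let list_term (alpha : R) n w : \bar R :=
  (if nth_list n is Some s then
    (first_layer_weight alpha s)%:E * (\prod_(i <- s) level_weight (a alpha) i w *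
       \prod_(o <- [:: @None nat]) ind (cells_are s) w)
  else 0)%E.

(** Outside the exceptional events the cells that meet the disk form a finite
    list and each [S i] has a level; the term of this list is then an upper
    bound. *)
Let nested_le alpha w : 0 <= alpha -> tame (So w) -> (forall i, ~ no_level (S i) w) ->
  ~ infiniteN w ->
  (expeR (alpha%:E * edge_length (nested So J C S) (@B1 R) w) <=
    \sum_(n <oo) list_term alpha n w)%E.
Proof.
move=> al0 tS uS /contrapT[s0 _ Ns0].
pose s := sort leq (undup s0).
have ss : sorted ltn s.
  by rewrite ltn_sorted_uniq_leq sort_uniq undup_uniq sort_sorted //; exact: leq_total.
have Ns : cells_are s w.
  rewrite /cells_are /= Ns0; apply/seteqP; split=> i /=; by rewrite mem_sort mem_undup.
have /boolp.choice[k Hk] : forall i, exists k, level k (S i w).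
  by move=> i; apply: level_ex; apply: contrapT => H; apply: (uS i) => k kw;
    apply: H; exists k.
have cov0 : length_bound (So w `&` @B1 R) (16 + 16 * (size s)%:R).
  apply: (@tame_length_bound _ _ (J w) (C w)) => //.
  - by move=> i Ji; have [+ _ _] := hC.1 w; apply.
  - by move=> A cA; have [_ _ +] := hC.1 w => /(_ _ cA)[i Ji <-]; exists i.
have cov1 : length_bound [set q | exists2 i, i \in s & (S i w `&` @B1 R) q]
    (\sum_(i <- s) 4 * (k i).+1%:R).
  by apply: length_bound_bigcup => i _; apply: short_length_bound; case: (Hk i).
have cov : length_bound (nested So J C S w `&` @B1 R)
    (16 + 16 * (size s)%:R + \sum_(i <- s) 4 * (k i).+1%:R).
  apply: length_boundS (lexx _) (length_boundU cov0 cov1) =>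
    q [[Sq|[i Ji [Sq Cq]]] q1]; first by left.
  right; exists i; last by split.
  suff : [set` s] i by [].
  by rewrite -Ns; split=> //; exists q.
apply: (@le_trans _ _ (list_term alpha (pickle s) w)); last first.
  apply: nneseries_ge_single => n; rewrite /list_term; case: (nth_list n) => // t.
  rewrite mule_ge0 ?lee_fin ?expR_ge0 // mule_ge0 //.
    elim/big_ind : _ => // [x y|i _]; first exact: mule_ge0.
    by apply: nneseries_ge0 => j _ _; rewrite mule_ge0 // lee_fin; exact: expR_ge0.
  by rewrite big_seq1.
rewrite /list_term nth_list_pickle // big_seq1 /ind indicE mem_set // mule1.
apply: (@le_trans _ _ (expeR (alpha%:E * (16 + 16 * (size s)%:R + \sum_(i <- s) 4 *
  (k i).+1%:R)%:E))).
  rewrite lee_expeR; apply: lee_wpmul2l; first by rewrite lee_fin.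
  exact: length_bound_hausdorff1.
rewrite -EFinM /= mulrDr expRD EFinM; apply: lee_wpmul2l;
  first by rewrite lee_fin expR_ge0.
have kY i : ((a alpha (k i))%:E <= level_weight (a alpha) i w)%E.
  apply: le_trans (nneseries_ge_single (k i) _); last first.
    by move=> j; rewrite mule_ge0 // lee_fin; exact: expR_ge0.
  by rewrite indicE mem_set ?mule1 //; exact: Hk.
rewrite mulr_sumr (big_morph expR (@expRD R) (@expR0 R)).
elim: (s) => [|i t IH]; first by rewrite !big_nil.
rewrite !big_cons EFinM; apply: lee_pmul => //; last exact: kY.
by rewrite lee_fin; elim/big_ind : _ => // x y; exact: mulr_ge0.
Qed.

(** The expectation is split according to the finite set of labels of the cells
    that meet the disk; the set of size [n] contributes at most [exp (16 alpha)
    exp (beta n)] times its probability. *)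
Lemma nested_moment (alpha m beta c : R) : 0 <= alpha -> 0 <= m ->
  (level_moment (fun k => expR (alpha * (4 * k.+1%:R))) <= m%:E)%E ->
  expR (16 * alpha) * m <= expR beta ->
  0 < beta -> (exp_moment P V beta < +oo)%E ->
  0 < c -> (exp_moment P L' c < +oo)%E ->
  (exp_moment P (edge_length (nested So J C S) (@B1 R)) alpha < +oo)%E.
Proof.
move=> al0 m0 Mm mb b0 Vb c0 Lc.
have a0 k : 0 <= a alpha k by exact: expR_ge0.
have Y0 i w : (0 <= level_weight (a alpha) i w)%E.
  by apply: nneseries_ge0 => j _ _; rewrite mule_ge0 // lee_fin.
have mY i : measurable_fun setT (level_weight (a alpha) i).
  apply: ge0_emeasurable_sum => [k w _ _|k _]; first by rewrite mule_ge0 // lee_fin.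
  by apply: emeasurable_funM => //; apply/measurable_EFinP; exact: measurable_indic.
have mcl s : measurable (cells_are s) by have [] := measurable_cells_are s.
have mprod s : measurable_fun setT (fun w =>
  (\prod_(i <- s) level_weight (a alpha) i w *
       \prod_(o <- [:: @None nat]) ind (cells_are s) w)%E).
  apply: emeasurable_funM.
    elim: s => [|i s IH]; first by under eq_fun do rewrite big_nil;
      exact: measurable_cst.
    by under eq_fun do rewrite big_cons; exact: emeasurable_funM.
  by under eq_fun do rewrite big_seq1; exact: mind.
have prod0 s w : (0 <= \prod_(i <- s) level_weight (a alpha) i w *
       \prod_(o <- [:: @None nat]) ind (cells_are s) w)%E.
  rewrite mule_ge0 //; last by rewrite big_seq1.
  by elim/big_ind : _ => // x y; exact: mule_ge0.
have term0 n w : (0 <= list_term alpha n w)%E.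
  by rewrite /list_term; case: (nth_list n) => // s;
    rewrite mule_ge0 // lee_fin expR_ge0.
have mterm n : measurable_fun setT (list_term alpha n).
  rewrite /list_term; case: (nth_list n) => [s|]; last exact: measurable_cst.
  exact: emeasurable_funM.
(* The integral of each term is a multiple of that of [g n], and the sum of the
   [g n] is at most [exp (beta V)]. *)
pose g n w : \bar R := (if nth_list n is Some s then
   (expR (beta * (size s)%:R))%:E * ind (cells_are s) w else 0)%E.
have g0 n w : (0 <= g n w)%E.
  by rewrite /g; case: (nth_list n) => // s; rewrite mule_ge0 // lee_fin expR_ge0.
have mg n : measurable_fun setT (g n).
  rewrite /g; case: (nth_list n) => [s|]; last exact: measurable_cst.
  by apply: emeasurable_funM => //; exact: mind.
have int_term n : (\int[P]_w list_term alpha n w <=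
  (expR (16 * alpha))%:E * \int[P]_w g n w)%E.
  rewrite /list_term /g; case E : (nth_list n) => [s|];
    last by rewrite !integral0 mule0.
  rewrite ge0_integralZl ?lee_fin ?expR_ge0 //.
  rewrite [X in (_ <= _ * X)%E]ge0_integralZl ?lee_fin ?expR_ge0 //; last exact: mind.
  have us : uniq (map (@Some nat) s ++ [:: None]).
    rewrite cat_uniq /= orbF map_inj_uniq; last by move=> ? ? [].
    rewrite (sorted_uniq ltn_trans ltnn) /=; last by case: (nth_listE E).
    by rewrite andbT; apply/negP => /mapP[].
  rewrite (integral_independent a0 us (F := fun=> cells_are s)); last first.
    by move=> o; rewrite inE => /eqP ->; have [] := measurable_cells_are s.
  rewrite (integral_indic _ measurableT) // setIT big_seq1 !muleA.
  apply: lee_wpmul2r => //.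
  have : (\prod_(i <- s) level_moment (a alpha) <= (m ^+ size s)%:E)%E.
    elim: (s) => [|i t IH]; first by rewrite big_nil.
    rewrite big_cons exprS EFinM; apply: lee_pmul => //.
    - by apply: nneseries_ge0 => k _ _; rewrite mule_ge0 // lee_fin.
    - elim/big_ind : _ => // [x y|j _]; first exact: mule_ge0.
      by apply: nneseries_ge0 => k _ _; rewrite mule_ge0 // lee_fin.
  move=> hm; apply: (@le_trans _ _ ((first_layer_weight alpha s)%:E * (m
    ^+ size s)%:E)%E).
    by apply: lee_wpmul2l => //; rewrite lee_fin expR_ge0.
  rewrite -!EFinM lee_fin /first_layer_weight mulrDr expRD -mulrA (mulrC alpha 16).
  rewrite ler_pM2l ?expR_gt0 // mulrA (mulrC alpha 16) !expRM_natr -exprMn.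
  by apply: lerXn2r => //; rewrite nnegrE ?expR_ge0 // mulr_ge0 // expR_ge0.
have gV w : (\sum_(n <oo) g n w <= expeR (beta%:E * V w))%E.
  have [[s [ss sw]]|ns] := pselect (exists s, sorted ltn s /\
    cells_are s w); last first.
    rewrite eseries0 ?expeR_ge0 // => n _ _; rewrite /g;
      case E : (nth_list n) => [s|//].
    rewrite /ind indicE memNset ?mule0 // => sw; apply: ns; exists s; split=> //.
    by case: (nth_listE E).
  apply: (@nneseries_le_single _ _ (pickle s)) => //; first exact: expeR_ge0.
    move=> n; rewrite /g; case E : (nth_list n) => [t|//]; have [st ->] := nth_listE E.
    move=> ne; rewrite /ind indicE memNset ?mule0 // => tw.
    suff ts : t = s by move: ne; rewrite ts eqxx.
    apply: (irr_sorted_eq ltn_trans ltnn) => // i.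
    have : [set` t] = [set` s] by rewrite -tw -sw.
    by move=> /seteqP[ts st']; apply/idP/idP => [/ts|/st'].
  rewrite /g nth_list_pickle // /ind indicE mem_set // mule1.
  apply: (@le_trans _ _ (expeR (beta%:E * (size s)%:R%:E))); first by rewrite -EFinM.
  rewrite lee_expeR; apply: lee_wpmul2l; first by rewrite lee_fin ltW.
  by apply: expVge => //; exact: sorted_uniq ltn_trans ltnn _ ss.
have unull : P.-negligible (\bigcup_i no_level (S i)).
  by apply: negligible_bigcup => i; exact: no_level_null Lc.
have fin : (\int[P]_w (\sum_(n <oo) list_term alpha n w) < +oo)%E.
  rewrite integral_nneseries //.
  apply: (@le_lt_trans _ _ (\sum_(n <oo) (expR (16 * alpha))%:E * \int[P]_w g n w)%E).
    by apply: lee_nneseries => n; [move=> _ _; apply: integral_ge0 => w _|move=> _;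
      exact: int_term].
  rewrite nneseriesZ ?lee_fin ?expR_ge0 //; last by move=> n;
    apply: integral_ge0 => w _.
  apply: lte_mul_pinfty; rewrite ?lee_fin ?expR_ge0 //.
  rewrite -integral_nneseries //; apply: le_lt_trans Vb.
  apply: integral_le_nonmeasurable => // w; exact: nneseries_ge0.
apply: le_lt_trans fin; apply: ae_le_integral_upper.
- by apply: ge0_emeasurable_sum => [k w _ _|k _].
- by move=> w; exact: nneseries_ge0.
- by move=> w; exact: expeR_ge0.
have h1 := ae_tame hSo.2.
have h2 : {ae P, forall w, ~ (\bigcup_i no_level (S i)) w}.
  by apply: negligibleS unull => w /= /contrapT.
have h3 : {ae P, forall w, ~ infiniteN w}.
  by apply: negligibleS (infiniteN_null b0 Vb) => w /= /contrapT.
apply: filterS3 h1 h2 h3 => w t1 t2 t3; apply: nested_le => // i ui.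
by apply: t2; exists i.
Qed.

Lemma exp_moment_le0 (T : Omega -> \bar R) alpha : alpha <= 0 ->
  (forall w, 0 <= T w)%E ->
  (exp_moment P T alpha < +oo)%E.
Proof.
move=> al0 T0; apply: (@le_lt_trans _ _ (\int[P]_w (cst 1%E) w)%E).
  apply: integral_le_nonmeasurable => w; first exact: expeR_ge0.
  rewrite /cst -[leRHS]expeR0 lee_expeR; apply: mule_le0_ge0 => //.
rewrite integral_cst // mul1e; apply: le_lt_trans (ltry 1).
exact: probability_le1.
Qed.

Lemma level_moment_shift (c : R) : (level_moment (fun k => expR (c * k.+1%:R)) =
  (expR c)%:E * level_moment (fun k => expR (c * k%:R)))%E.
Proof.
rewrite /level_moment -nneseriesZ ?lee_fin ?expR_ge0 //; last by move=> k;
  rewrite mule_ge0 // lee_fin expR_ge0.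
by apply: eq_eseriesr => k _; rewrite muleA -EFinM -expRD -natr1 mulrDr mulr1 addrC.
Qed.

Lemma sum_levels_le1 : (\sum_(k <oo) p k <= 1)%E.
Proof.
rewrite -measure_semi_bigcup //.
- by apply: probability_le1; exact: bigcupT_measurable.
- by move=> i j _ _ [w [iw jw]]; exact: level_uniq iw jw.
- exact: bigcupT_measurable.
Qed.

Lemma nested_all_moments : (forall alpha : R, (exp_moment P V alpha < +oo)%E) ->
  (forall alpha : R, (exp_moment P L' alpha < +oo)%E) ->
  forall alpha : R, (exp_moment P (edge_length (nested So J C S) (@B1
    R)) alpha < +oo)%E.
Proof.
move=> HV HL alpha; have [al0|al0] := leP alpha 0.
  by apply: exp_moment_le0 => // w; exact: edge_length_ge0.
pose m := fine (level_moment (fun k => expR (alpha * (4 * k.+1%:R)))).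
have M0 : (0 <= level_moment (fun k => expR (alpha * (4 * k.+1%:R))))%E.
  by apply: nneseries_ge0 => k _ _; rewrite mule_ge0 // lee_fin expR_ge0.
have Mfin : level_moment (fun k => expR (alpha * (4 * k.+1%:R))) \is a fin_num.
  rewrite ge0_fin_numE //.
  have -> : level_moment (fun k =>
    expR (alpha * (4 * k.+1%:R))) = level_moment (fun k => expR (alpha * 4 * k.+1%:R)).
    by apply: eq_eseriesr => k _; rewrite mulrA.
  rewrite level_moment_shift; apply: lte_mul_pinfty; rewrite ?lee_fin ?expR_ge0 //.
  by apply: le_lt_trans (levels_moment _) (HL _); rewrite mulr_ge0 // ltW.
have m0 : 0 <= m by exact: fine_ge0.
(* By [1 + b <= exp b], a linear choice of [b] is enough; the term 1 makes it
   positive. *)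
pose b := expR (16 * alpha) * m + 1.
have b0 : 0 < b by rewrite ltr_wpDl // mulr_ge0 // expR_ge0.
apply: (@nested_moment alpha m b 1) => //; first exact: ltW.
  by rewrite fineK.
by apply: le_trans (expR_ge1Dx _); rewrite /b; have := expR_ge0 (16 * alpha); nra.
Qed.

Lemma nested_some_moment : (exists2 alpha : R,
  0 < alpha & (exp_moment P V alpha < +oo)%E) ->
  (exists2 alpha : R, 0 < alpha & (exp_moment P L' alpha < +oo)%E) ->
  exists2 alpha : R, 0 < alpha &
    (exp_moment P (edge_length (nested So J C S) (@B1 R)) alpha < +oo)%E.
Proof.
move=> [b b0 HV] [c c0 HL].
pose Q := level_moment (fun k => expR (c * k.+1%:R)).
have Q0 : (0 <= Q)%E by apply: nneseries_ge0 => k _ _;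
  rewrite mule_ge0 // lee_fin expR_ge0.
have Qfin : Q \is a fin_num.
  rewrite ge0_fin_numE // /Q level_moment_shift; apply: lte_mul_pinfty;
    rewrite ?lee_fin ?expR_ge0 //.
  by apply: le_lt_trans (levels_moment _) HL; exact: ltW.
pose q := fine Q; have q0 : 0 <= q by exact: fine_ge0.
have den0 : 0 < 4 * c + q by rewrite ltr_wpDr // mulr_gt0.
(* With [alpha = t c / 4] the condition [16 alpha + t q <= b] is linear
   in [t]. *)
pose t := Num.min 1 (b / (4 * c + q)).
have t0 : 0 < t by rewrite lt_min ltr01 divr_gt0.
have t1 : t <= 1 by rewrite ge_min lexx.
have tb : t * (4 * c + q) <= b by rewrite -ler_pdivlMr // ge_min lexx orbT.
exists (t * c / 4); first by rewrite !mulr_gt0.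
apply: (@nested_moment _ (expR (t * q)) b c) => //.
- by rewrite ltW // !mulr_gt0.
- apply: (@le_trans _ _ (\sum_(k <oo) ((1 - t)%:E * p k + t%:E * ((expR (c *
  k.+1%:R))%:E * p k)))%E).
    apply: lee_nneseries => k _; first by move=> _;
      rewrite mule_ge0 // lee_fin expR_ge0.
    rewrite muleA -ge0_muleDl ?lee_fin ?mulr_ge0 ?expR_ge0 ?subr_ge0 ?(ltW t0) //.
    apply: lee_wpmul2r => //; rewrite lee_fin.
    have -> : t * c / 4 * (4 * k.+1%:R) = t * (c * k.+1%:R) by field.
    by apply: expR_convex; rewrite t1 ltW.
  have p0 k : (0 <= p k)%E by exact: measure_ge0.
  rewrite nneseriesD; last 2 first.
  - by move=> k _; rewrite mule_ge0 // lee_fin subr_ge0.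
  - by move=> k _; rewrite mule_ge0 ?lee_fin ?(ltW t0) // mule_ge0 // lee_fin expR_ge0.
  rewrite !nneseriesZ ?lee_fin ?subr_ge0 ?(ltW t0) //; last first.
    by move=> k; rewrite mule_ge0 // lee_fin expR_ge0.
  rewrite -/(level_moment _) -/Q -(fineK Qfin) -/q.
  apply: (@le_trans _ _ ((1 - t)%:E + t%:E * q%:E)%E).
    apply: leeD => //; rewrite -[leRHS]mule1; apply: lee_wpmul2l;
      last exact: sum_levels_le1.
    by rewrite lee_fin subr_ge0.
  rewrite -EFinM -EFinD lee_fin; apply: le_trans (expR_ge1Dx _).
  by rewrite lerD2r gerBl ltW.
- rewrite -expRD ler_expR; apply: le_trans tb; rewrite mulrDr lerD2r; lra.
Qed.
End Moments.

Theorem corollary1p3 (R : realType) (d : measure_display)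
    (Omega : measurableType d) (P : probability Omega R)
    (tauo tau' : tess_type R)
    (So : Omega -> set (R * R)) (J : Omega -> set nat)
    (C : Omega -> nat -> set (R * R))
    (S : nat -> Omega -> set (R * R)) (S' : Omega -> set (R * R))
    (hSo : basic_tessellation P tauo So)
    (hC : cell_enumeration So J C)
    (hS' : basic_tessellation P tau' S')
    (hS : forall i, basic_tessellation P tau' (S i) /\ same_law P (S i) S')
    (hind : mutually_independent P (fun o : option nat =>
       if o is Some i then sigma_set (S i) else sigma_first_layer So J C)) :
  ((forall alpha : R, (exp_moment P (ncells_B1 J C) alpha < +oo)%E) ->
   (forall alpha : R,
      (exp_moment P (edge_length S' (B1 (R := R))) alpha < +oo)%E) ->
   forall alpha : R,
     (exp_moment P (edge_length (nested So J C S) (B1 (R := R))) alpha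
        < +oo)%E) /\
  ((exists2 alpha : R, 0 < alpha &
      (exp_moment P (ncells_B1 J C) alpha < +oo)%E) ->
   (exists2 alpha : R, 0 < alpha &
      (exp_moment P (edge_length S' (B1 (R := R))) alpha < +oo)%E) ->
   exists2 alpha : R, 0 < alpha &
     (exp_moment P (edge_length (nested So J C S) (B1 (R := R))) alpha
        < +oo)%E).
Proof.
split.
- exact: (nested_all_moments hSo hC hS' hS hind).
- exact: (nested_some_moment hSo hC hS' hS hind).
Qed.
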